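(* Suppose $M-2\notin-2\mathbb N$. Then the Bessel--Fischer product is non-degenerate on the polynomial Fock space $\mathcal F=\mathcal P(\mathbb C^{m|2n})/\langle R^2\rangle$, i.e. if $p\in\mathcal F$ satisfies $\langle p,q\rangle_{\mathcal B}=0$ for all $q\in\mathcal F$, then $p=0$.
   Context: $\mathbb N=\{0,1,2,\dots\}$. Fix integers $m\ge 2$, $n\ge 0$ and put $M=m-2n$. Set $|i|=0$ for $0\le i\le m-1$ and $|i|=1$ for $m\le i\le m+2n-1$. $\mathcal P(\mathbb C^{m|2n})=\mathbb C[z_0,\dots,z_{m-1}]\otimes\Lambda(z_m,\dots,z_{m+2n-1})$ is the superalgebra of complex superpolynomials, with $z_iz_j=(-1)^{|i||j|}z_jz_i$. $\beta=(\beta_{ij})_{i,j=0}^{m+2n-1}$ is the matrix with $\beta_{00}=-1$, $\beta_{ii}=1$ for $1\le i\le m-1$, $\beta_{m+i,m+n+i}=-1$ and $\beta_{m+n+i,m+i}=1$ for $0\le i<n$, all other entries $0$; $(\beta^{ij})$ is its inverse matrix. $\partial^i$ is the (left) superderivation of parity $|i|$ with $\partial^i(z_j)=\delta_{ij}$, and $\partial_j=\sum_i\beta_{ji}\partial^i$. Put $R^2=\sum_{i,j}\beta^{ij}z_iz_j$, $\mathbb E=\sum_{i,j}\beta^{ij}z_i\partial_j$, $\Delta=\sum_{i,j}\beta^{ij}\partial_i\partial_j$; $\langle R^2\rangle$ is the ideal generated by $R^2$. Bessel operators: $\mathcal B(z_k)=(M-2+2\mathbb E)\partial_k-z_k\Delta$;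 modified: $\widetilde{\mathcal B}(z_0)=-\mathcal B(z_0)$, $\widetilde{\mathcal B}(z_k)=\mathcal B(z_k)$ for $k\ge1$. They supercommute and preserve $\langle R^2\rangle$. The Bessel--Fischer product is $\langle p,q\rangle_{\mathcal B}=p(\widetilde{\mathcal B})\,\bar q(z)|_{z=0}$, where $p(\widetilde{\mathcal B})$ replaces each $z_i$ by $\widetilde{\mathcal B}(z_i)$ (keeping the order of factors) and $\bar q$ is $q$ with complex conjugated coefficients; it vanishes if one argument lies in $\langle R^2\rangle$, hence is well defined on $\mathcal F$. *)

(* Defs.v *)
From HB Require Import structures.
From mathcomp Require Import all_boot all_order all_algebra.
From mathcomp Require Import ring boolp.
From mathcomp Require Import mpoly ring_quotient generic_quotient.

Set Implicit Arguments.
Unset Strict Implicit.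
Unset Printing Implicit Defensive.

Import Order.TTheory GRing.Theory Num.Theory.
Local Open Scope ring_scope.

(* A superpolynomial in m even and k odd variables is stored through its
   coefficients on the monomials theta_S (S a set of odd indices), where theta_S
   is the product of the odd variables of S in increasing order: p stands for
   \sum_S (p S) theta_S. *)
Definition superpoly (C : comNzRingType) (m k : nat) : Type :=
  {ffun {set 'I_k} -> {mpoly C[m]}}.

HB.instance Definition _ (C : comNzRingType) (m k : nat) :=
  GRing.Lmodule.copy (superpoly C m k) {ffun {set 'I_k} -> {mpoly C[m]}}.

Section SuperPolyRing.
Variables (C : comNzRingType) (m k : nat).
Implicit Types (p q r : superpoly C m k) (S T U : {set 'I_k}).

Definition inversions S T : nat := \sum_(s in S) \sum_(t in T) (t < s)%N.

(* theta_S theta_T = (-1) ^ (inversions S T) theta_(S :|: T) for disjoint S, T,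
   and 0 otherwise. *)
Definition spmul p q : superpoly C m k :=
  [ffun U : {set _} => \sum_(S : {set 'I_k} | S \subset U)
     (-1) ^+ inversions S (U :\: S) * (p S * q (U :\: S))].

Definition spone : superpoly C m k := [ffun S : {set _} => (S == set0)%:R].

Lemma inversionsUl S T U : [disjoint S & T] ->
  inversions (S :|: T) U = (inversions S U + inversions T U)%N.
Proof.
by move=> dST; rewrite /inversions -bigU //=; apply: eq_bigl => x; rewrite inE.
Qed.

Lemma inversionsUr S T U : [disjoint S & T] ->
  inversions U (S :|: T) = (inversions U S + inversions U T)%N.
Proof.
move=> dST; rewrite /inversions -big_split /=; apply: eq_bigr => s _.
by rewrite -bigU //=; apply: eq_bigl => x; rewrite inE.
Qed.

Lemma inversions0l S : inversions set0 S = 0%N.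
Proof. by rewrite /inversions big_set0. Qed.

Lemma inversions0r S : inversions S set0 = 0%N.
Proof. by rewrite /inversions big1 // => s _; rewrite big_set0. Qed.

Lemma spmulA : associative spmul.
Proof.
move=> p q r; apply/ffunP => U; rewrite !ffunE.
under eq_bigr => S _ do rewrite ffunE mulr_sumr mulr_sumr.
under [in RHS]eq_bigr => V _ do rewrite ffunE mulr_suml mulr_sumr.
rewrite [RHS](exchange_big_dep (fun S => S \subset U)) /=; last first.
  by move=> V S VU /subset_trans; apply.
apply: eq_bigr => S SU.
rewrite [RHS](reindex_onto (fun T => S :|: T) (fun V => V :\: S)) /=; last first.
  by move=> V /andP[_ SV]; rewrite -{1}(setIidPr SV) setID.
have dS T : ((S :|: T) :\: S == T) = [disjoint S & T].
  rewrite setDUl setDv set0U; apply/eqP/idP => [<-|].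
    by rewrite -setI_eq0 setIDA setDIl setDv set0I.
  by move=> d; apply/setDidPl; rewrite disjoint_sym.
apply: eq_big => [T|T].
  by rewrite dS subUset SU subsetUl !andbT subsetD disjoint_sym.
rewrite subsetD disjoint_sym => /andP[TU dST].
have -> : U :\: (S :|: T) = (U :\: S) :\: T by rewrite setDDl.
have -> : (S :|: T) :\: S = T by apply/eqP; rewrite dS.
set W := (U :\: S) :\: T.
have -> : U :\: S = T :|: W.
  rewrite /W -{1}(setID (U :\: S) T); congr (_ :|: _).
  by apply/setIidPr; rewrite subsetD TU disjoint_sym.
rewrite inversionsUl // inversionsUr; last first.
  by rewrite -setI_eq0 /W setIDA setDIl setDv set0I.
by rewrite !exprD; ring.
Qed.

Lemma spmul1p : left_id spone spmul.
Proof.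
move=> p; apply/ffunP => U; rewrite ffunE (bigD1 set0) ?sub0set //= ffunE eqxx.
rewrite inversions0l setD0 expr0 !mul1r big1 ?addr0 // => S /andP[_ /negPf S0].
by rewrite ffunE S0 mul0r mulr0.
Qed.

Lemma spmulp1 : right_id spone spmul.
Proof.
move=> p; apply/ffunP => U; rewrite ffunE (bigD1 U) //= ffunE setDv eqxx.
rewrite inversions0r expr0 mul1r mulr1 big1 ?addr0 // => S /andP[SU SnU].
rewrite ffunE setD_eq0; case: (boolP (U \subset S)) => US; last by rewrite !mulr0.
by rewrite eqEsubset SU US in SnU.
Qed.

Lemma spmulDl : left_distributive spmul +%R.
Proof.
move=> p q r; apply/ffunP => U; rewrite !ffunE -big_split /=.
by apply: eq_bigr => S _; rewrite ffunE mulrDl mulrDr.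
Qed.

Lemma spmulDr : right_distributive spmul +%R.
Proof.
move=> p q r; apply/ffunP => U; rewrite !ffunE -big_split /=.
by apply: eq_bigr => S _; rewrite ffunE mulrDr mulrDr.
Qed.

Lemma spone_neq0 : spone != 0.
Proof.
by apply/eqP => /ffunP /(_ set0) /eqP; rewrite !ffunE eqxx oner_eq0.
Qed.

HB.instance Definition _ := GRing.Zmodule_isNzRing.Build (superpoly C m k)
  spmulA spmul1p spmulp1 spmulDl spmulDr spone_neq0.

Lemma spmul_scalel (c : C) p q : c *: (p * q) = (c *: p) * q.
Proof.
apply/ffunP => U; rewrite !ffunE scaler_sumr; apply: eq_bigr => S _.
by rewrite ffunE scalerAr scalerAl.
Qed.

HB.instance Definition _ :=
  GRing.Lmodule_isLalgebra.Build C (superpoly C m k) spmul_scalel.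

Lemma spmul_scaler (c : C) p q : c *: (p * q) = p * (c *: q).
Proof.
apply/ffunP => U; rewrite !ffunE scaler_sumr; apply: eq_bigr => S _.
by rewrite ffunE !scalerAr.
Qed.

HB.instance Definition _ :=
  GRing.Lalgebra_isAlgebra.Build C (superpoly C m k) spmul_scaler.

(* The variables z_0, ..., z_(m-1) are even, z_m, ..., z_(m+k-1) are odd. *)
Definition parity (i : 'I_(m + k)) : nat := (m <= i)%N.

Definition spmonom (c : {mpoly C[m]}) S : superpoly C m k :=
  [ffun T : {set _} => if T == S then c else 0].

Definition spvar (i : 'I_(m + k)) : superpoly C m k :=
  match split i with
  | inl a => spmonom 'X_a set0
  | inr b => spmonom 1 [set b]
  end.

Lemma spmonomM c d S T : spmonom c S * spmonom d T =
  if [disjoint S & T] then spmonom ((-1) ^+ inversions S T * (c * d)) (S :|: T)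
  else 0.
Proof.
apply/ffunP => U; rewrite ffunE.
have -> : \sum_(V : {set 'I_k} | V \subset U)
      (-1) ^+ inversions V (U :\: V) * (spmonom c S V * spmonom d T (U :\: V)) =
    if (S \subset U) && (U :\: S == T)
    then (-1) ^+ inversions S T * (c * d) else 0.
  case: (boolP (S \subset U)) => SU /=; last first.
    rewrite big1 // => V VU; rewrite ffunE; case: eqP => [VS|]; last first.
      by rewrite mul0r mulr0.
    by rewrite -VS VU in SU.
  rewrite (bigD1 S) //= big1 ?addr0 => [|V /andP[_ /negPf VS]]; last first.
    by rewrite ffunE VS mul0r mulr0.
  by rewrite !ffunE eqxx; case: eqP => [->|]; rewrite ?mulr0.
have -> : (S \subset U) && (U :\: S == T) =
    [disjoint S & T] && (U == S :|: T).
  apply/andP/andP => [[SU /eqP<-]|[dST /eqP->]].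
    split; first by rewrite -setI_eq0 setIDA setDIl setDv set0I.
    by rewrite -{1}(setIidPr SU) setID.
  rewrite subsetUl setDUl setDv set0U; split=> //; apply/eqP/setDidPl.
  by rewrite disjoint_sym.
by case: ifP => [/andP[-> /eqP->]|]; [|case: [disjoint S & T] => /= H];
  rewrite !ffunE ?eqxx ?H.
Qed.

Lemma spvar_supercomm (i j : 'I_(m + k)) :
  spvar i * spvar j = (-1) ^+ (parity i * parity j) * (spvar j * spvar i).
Proof.
rewrite /spvar /parity; case: (splitP i) => a ->; case: (splitP j) => b ->;
  rewrite ?leq_addr 1?[(m <= _)%N]leqNgt ?ltn_ord ?muln0 ?mul0n ?expr0 ?mul1r
    !spmonomM.
- by rewrite inversions0l mulrC [in LHS](mulrC 'X_a) mulrC.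
- by rewrite disjoint_sym setUC inversions0l inversions0r [X in _ * X]mulrC.
- by rewrite disjoint_sym setUC inversions0l inversions0r [X in _ * X]mulrC.
rewrite mulN1r disjoint_sym setUC; case: ifP; rewrite ?oppr0 // => dab.
apply/ffunP => U; rewrite !ffunE; case: ifP; rewrite ?oppr0 // => _.
have inv1 x y : inversions [set x] [set y] = (y < x)%N.
  by rewrite /inversions !big_set1.
rewrite !inv1 !mulr1; case: (ltngtP a b) => [||/val_inj ab].
- by rewrite opprK.
- by [].
by move: dab; rewrite ab disjoints1 inE eqxx.
Qed.

(* The superderivation of parity |i| sending z_j to (i == j): moving z_(m+b) to
   the front of theta_S costs one sign for each index of S below b. *)
Definition spderiv (i : 'I_(m + k)) p : superpoly C m k :=
  match split i with
  | inl a => [ffun S : {set _} => (p S)^`M(a)]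
  | inr b => [ffun S : {set _} => if b \in S then 0 else
                (-1) ^+ (\sum_(s in S) (s < b)%N) * p (b |: S)]
  end.

Lemma spderiv_var (i j : 'I_(m + k)) : spderiv i (spvar j) = (i == j)%:R.
Proof.
have oneE : (1 : superpoly C m k) = [ffun S : {set _} => (S == set0)%:R] by [].
rewrite /spderiv /spvar -val_eqE /=; case: (splitP i) => a ->;
  case: (splitP j) => b ->; apply/ffunP => S; rewrite !ffunE.
- rewrite val_eqE; case: (S =P set0) => [->|/eqP/negPf S0].
    rewrite mderivX mnmE eq_sym; case: eqP => [->|] /=; last first.
      by rewrite mulr0n scale0r ffunE.
    have -> : (U_(b) - U_(b) = 0)%MM by apply/mnmP=> l; rewrite !mnmE subnn.
    by rewrite oneE ffunE eqxx mpolyX0 scale1r.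
  by rewrite mderiv0; case: eqP; rewrite ?oneE !ffunE ?S0.
- by rewrite ltn_eqF ?ltn_addr // [RHS]ffunE; case: eqP; rewrite ?mderivC ?raddf0.
- rewrite gtn_eqF ?ltn_addr // [RHS]ffunE; case: ifP => // _.
  by rewrite setU_eq0 -cards_eq0 cards1 mulr0.
rewrite eqn_add2l val_eqE; case: ifP => [aS|/negbT aS].
  case: eqP; rewrite ?oneE ffunE //; case: eqP => // S0.
  by rewrite S0 inE in aS.
have -> : (a |: S == [set b]) = (S == set0) && (a == b).
  apply/eqP/andP => [e|[/eqP-> /eqP->]]; last by rewrite setU0.
  have ab : a = b by apply/set1P; rewrite -e setU11.
  split; last by rewrite ab.
  apply/eqP/setP => x; rewrite inE; apply/negP => xS.
  have : x \in a |: S by rewrite inE xS orbT.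
  by rewrite e -ab => /set1P xa; rewrite xa in xS; rewrite xS in aS.
case: eqP => [->|/eqP/negPf S0] /=.
  by rewrite big_set0 mul1r; case: eqP; rewrite ?oneE ffunE ?eqxx.
by rewrite mulr0; case: eqP; rewrite ?oneE ffunE ?S0.
Qed.

End SuperPolyRing.

(* The two-sided ideal of a ring generated by one element. *)
Definition gen_ideal (A : nzRingType) (x : A) : {pred A} :=
  fun y => `[< exists s : seq (A * A), y = \sum_(ab <- s) ab.1 * x * ab.2 >].
Arguments gen_ideal : clear implicits.

Lemma gen_ideal_zmod_closed (A : nzRingType) (x : A) :
  zmod_closed (gen_ideal A x).
Proof.
split=> [|u v /asboolP[s ->] /asboolP[t ->]]; apply/asboolP.
  by exists [::]; rewrite big_nil.
exists (s ++ [seq (- ab.1, ab.2) | ab <- t]); rewrite big_cat big_map /= -sumrN.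
by congr (_ + _); apply: eq_bigr => ab _; rewrite !mulNr.
Qed.

HB.instance Definition _ (A : nzRingType) (x : A) :=
  GRing.isZmodClosed.Build A (gen_ideal A x) (gen_ideal_zmod_closed x).

Section BesselFischer.
Variables (C : numClosedFieldType) (m n : nat).
Local Notation P := (superpoly C m (2 * n)).
Local Notation I := 'I_(m + 2 * n).
Implicit Types (p q : P) (i j k : I).

Definition superdim : int := m%:Z - (2 * n)%:Z.

Definition beta : 'M[C]_(m + 2 * n) :=
  \matrix_(i, j)
    if i == 0 :> nat then (if j == 0 :> nat then -1 else 0)
    else if (i < m)%N then (i == j)%:R
    else if (i < m + n)%N then (if j == (i + n)%N :> nat then -1 else 0)
    else (i == (j + n)%N :> nat)%:R.

Local Notation betaV := (invmx beta).

Definition spderiv_low j p : P := \sum_i beta j i *: spderiv i p.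

Definition Rsq : P := \sum_i \sum_j betaV i j *: (spvar C i * spvar C j).

Definition euler p : P :=
  \sum_i \sum_j betaV i j *: (spvar C i * spderiv_low j p).

Definition laplace p : P :=
  \sum_i \sum_j betaV i j *: spderiv_low i (spderiv_low j p).

Definition bessel k p : P :=
  (superdim - 2)%:~R *: spderiv_low k p + 2 *: euler (spderiv_low k p)
  - spvar C k * laplace p.

Definition bessel_mod k p : P :=
  if k == 0 :> nat then - bessel k p else bessel k p.

(* The monomial z^a theta_S with each z_i replaced by the operator T i: the even
   factors in increasing order, followed by the odd ones in increasing order;
   the leftmost factor is applied last. *)
Definition subst_monomial (T : I -> P -> P) (a : 'X_{1..m})
    (S : {set 'I_(2 * n)}) q : P :=
  foldr (fun (i : 'I_m) r => iter (a i) (T (lshift _ i)) r)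
    (foldr (fun (j : 'I_(2 * n)) r => T (rshift m j) r) q (enum S)) (enum 'I_m).

Definition subst_op (T : I -> P -> P) p q : P :=
  \sum_(S : {set 'I_(2 * n)}) \sum_(a <- msupp (p S))
    (p S)@_a *: subst_monomial T a S q.

Definition conj_coef q : P :=
  [ffun S : {set _} => map_mpoly (fun c : C => c^*) (q S)].

Definition eval0 p : C := (p set0)@_0%MM.

Definition bessel_fischer p q : C := eval0 (subst_op bessel_mod p (conj_coef q)).

Definition fock : zmodType := Quotient.quot (gen_ideal P Rsq).

(* bessel_fischer vanishes as soon as one argument lies in the ideal of Rsq, so
   the choice of representatives is irrelevant. *)
Definition fock_form (f g : fock) : C := bessel_fischer (repr f) (repr g).

End BesselFischer.

(* Main.v *)
Require Import Defs.
From HB Require Import structures.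
From mathcomp Require Import all_boot all_order all_algebra.
From mathcomp Require Import ring zify boolp.
From mathcomp Require Import mpoly ring_quotient generic_quotient.
From mathcomp Require Import reals complex.

(* Let T_k be the derivative \partial_k, with the sign changed for k = 0.  If
   Delta h = 0 and E h = g h, then the modified Bessel operator of z_k acts on h
   as (M - 2 + 2 (g - 1)) T_k, and T_k h is again harmonic, of degree g - 1.
   Hence <p, h>_B is the nonzero number \prod_(j < g) (M - 2 + 2 j) times the
   Fischer pairing (p(T) h)(0).
   For this pairing multiplication by R^2 is adjoint to Delta.  As R^2 has the
   term -z_0^2, division by R^2 gives p = r R^2 + q with q of degree at most 1
   in z_0, and (p(T) h)(0) = (q(T) h)(0).  If q had a nonzero coefficient, write
   the dual monomial as z_0^e f with e <= 1 and f free of z_0, and extend it to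
   the harmonic polynomial
     h = \sum_j z_0^(2j+e) / (2j+e)! (Delta + d_0^2)^j f
   (Cauchy-Kovalevskaya extension).  Only the term j = 0 pairs nontrivially with
   q, which contradicts (q(T) h)(0) = 0. *)

Set Implicit Arguments.
Unset Strict Implicit.
Unset Printing Implicit Defensive.

Import Order.TTheory GRing.Theory Num.Theory.
Local Open Scope ring_scope.

(** * Coordinates of multiplication and derivation; the Weyl superalgebra relation *)

Section SuperWeyl.
Variables (C : comNzRingType) (m k : nat).
Local Notation P := (superpoly C m k).
Local Notation I := 'I_(m + k).
Local Notation z := (@spvar C m k).
Implicit Types (p q : P) (S T U : {set 'I_k}) (i j : I).

(** The number of variables of theta_S that theta_b passes between the front and its place in the
    increasing order; the exponent of the sign in [spderiv]. *)
Definition below S (b : 'I_k) : nat := \sum_(s in S) (s < b)%N.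

Lemma belowU1 S b c : c \notin S -> below (c |: S) b = ((c < b) + below S b)%N.
Proof. by move=> cS; rewrite /below big_setU1. Qed.

Lemma belowD1 S b c : c \in S -> below S b = ((c < b) + below (S :\ c) b)%N.
Proof. by move=> cS; rewrite /below (big_setD1 c). Qed.

Lemma split_lshift (a : 'I_m) : split (lshift k a) = inl a.
Proof. exact: (unsplitK (inl a)). Qed.

Lemma split_rshift (b : 'I_k) : split (rshift m b) = inr b.
Proof. exact: (unsplitK (inr b)). Qed.

Lemma spvar_evenM (a : 'I_m) p U : (z (lshift k a) * p) U = 'X_a * p U.
Proof.
rewrite /spvar split_lshift [LHS]ffunE (bigD1 set0) ?sub0set //= big1 ?addr0.
  by rewrite ffunE eqxx inversions0l setD0 mul1r.
by move=> S /andP[_ /negPf S0]; rewrite ffunE S0 mul0r mulr0.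
Qed.

Lemma spvar_oddM (b : 'I_k) p U : (z (rshift m b) * p) U =
  if b \in U then (-1) ^+ below U b * p (U :\ b) else 0.
Proof.
rewrite /spvar split_rshift [LHS]ffunE; case: ifP => bU.
  rewrite (bigD1 [set b]) ?sub1set //= big1 ?addr0.
    rewrite ffunE eqxx mul1r /inversions big_set1 (belowD1 _ bU) ltnn.
    by [].
  by move=> S /andP[_ /negPf S0]; rewrite ffunE S0 mul0r mulr0.
rewrite big1 // => S SU; rewrite ffunE; case: eqP => [Sb|]; last first.
  by rewrite mul0r mulr0.
by rewrite Sb sub1set bU in SU.
Qed.

Lemma spderiv_lshift (a : 'I_m) p U : spderiv (lshift k a) p U = (p U)^`M(a).
Proof. by rewrite /spderiv split_lshift ffunE. Qed.

Lemma spderiv_rshift (b : 'I_k) p U : spderiv (rshift m b) p U =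
  if b \in U then 0 else (-1) ^+ below U b * p (b |: U).
Proof. by rewrite /spderiv split_rshift ffunE. Qed.

Lemma parity_lshift a : parity (lshift k a : I) = 0%N.
Proof. by rewrite /parity /= leqNgt ltn_ord. Qed.

Lemma parity_rshift b : parity (rshift m b : I) = 1%N.
Proof. by rewrite /parity /= leq_addr. Qed.

Variant shift_spec : I -> Type :=
  | ShiftL a : shift_spec (lshift k a)
  | ShiftR b : shift_spec (rshift m b).

Lemma shiftP i : shift_spec i.
Proof. by rewrite -(splitK i); case: (split i) => a; constructor. Qed.

(** The Koszul sign, kept as a scalar so that it acts by [*:] on any module. *)
Definition ksign i j : C := (-1) ^+ (parity i * parity j).

Lemma spderiv_is_linear i : linear (@spderiv C m k i).
Proof.
move=> c p q; apply/ffunP => U; rewrite ffunE [X in _ = X + _]ffunE.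
case: (shiftP i) => a.
  by rewrite !spderiv_lshift !ffunE mderivD mderivZ.
rewrite !spderiv_rshift; case: ifP => _; first by rewrite scaler0 addr0.
by rewrite !ffunE mulrDr scalerAr.
Qed.

HB.instance Definition _ i := GRing.isLinear.Build C P P *:%R
  (@spderiv C m k i) (spderiv_is_linear i).

Lemma spderivD i p q : spderiv i (p + q) = spderiv i p + spderiv i q.
Proof. exact: linearD. Qed.

Lemma spderivZ i (c : C) p : spderiv i (c *: p) = c *: spderiv i p.
Proof. exact: linearZ. Qed.

Lemma spderiv0 i : spderiv i (0 : P) = 0.
Proof. exact: linear0. Qed.

Lemma spderivN i p : spderiv i (- p) = - spderiv i p.
Proof. exact: linearN. Qed.

Lemma spderiv_sum i (J : finType) (F : J -> P) :
  spderiv i (\sum_a F a) = \sum_a spderiv i (F a).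
Proof. exact: linear_sum. Qed.

Lemma spaddE p q U : (p + q) U = p U + q U.
Proof. exact: ffunE. Qed.

Lemma spscaleE (c : C) p U : (c *: p) U = c *: p U.
Proof. exact: ffunE. Qed.

Lemma sp0E U : (0 : P) U = 0.
Proof. exact: ffunE. Qed.

(** The super Leibniz rule for a left factor z_j, checked on coefficients in the four parity cases.
    The commutators with R^2 and the Euler operator are later derived from it. *)
Lemma weyl i j p : spderiv i (z j * p) =
  (i == j)%:R *: p + ksign i j *: (z j * spderiv i p).
Proof.
apply/ffunP => U; rewrite spaddE !spscaleE /ksign.
case: (shiftP i) => a; case: (shiftP j) => b; rewrite ?parity_lshift
  ?parity_rshift ?mul0n ?muln0 ?expr0 ?expr1 ?scale1r ?eq_lrshift ?eq_rlshift.
- rewrite eq_lshift spderiv_lshift !spvar_evenM spderiv_lshift mderivM mderivX.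
  rewrite mnm1E [b == a]eq_sym; case: (eqVneq a b) => [->|_] /=; last first.
    by rewrite !scale0r mul0r.
  have -> : (U_(b) - U_(b) = 0)%MM by apply/mnmP=> l; rewrite !mnmE subnn.
  by rewrite mpolyX0 !scale1r mul1r.
- rewrite scale0r add0r spderiv_lshift !spvar_oddM; case: ifP => _.
    by rewrite spderiv_lshift -signr_odd !mulr_sign; case: odd;
      rewrite ?mderivN.
  by rewrite raddf0.
- rewrite scale0r add0r spderiv_rshift !spvar_evenM spderiv_rshift.
  by case: ifP => _; [rewrite mulr0 | rewrite mulrCA].
rewrite eq_rshift !scaleN1r spderiv_rshift !spvar_oddM.
case: (eqVneq a b) => [<-|ab]; rewrite ?scale1r ?scale0r ?add0r.
  rewrite spderiv_rshift setU11 setD11; case: ifP => aU.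
    rewrite (setD1K aU) (belowD1 _ aU) ltnn mulrA -expr2.
    by rewrite sqrr_sign mul1r subrr.
  rewrite subr0 belowU1 ?aU // ltnn mulrA -expr2 sqrr_sign mul1r.
  by rewrite setU1K ?aU.
rewrite spderiv_rshift !inE eq_sym (negPf ab) /=; case: ifP => aU.
  by case: ifP; rewrite ?mulr0 ?oppr0.
case: ifP => bU; last by rewrite mulr0 oppr0.
have -> : (a |: U) :\ b = a |: (U :\ b).
  by rewrite setDUl; congr (_ :|: _); apply/setDidPl; rewrite disjoints1 inE.
(* Inserting a shifts one exponent by (a < b), removing b shifts another by (b < a); together they
   give the single sign of two distinct odd indices. *)
rewrite belowU1 ?aU // (belowD1 _ bU) !exprD.
by case: (ltngtP a b) ab => [_|_|/val_inj->]; rewrite ?eqxx // => _; ring.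
Qed.

End SuperWeyl.

(** * Induction along products of variables; the Euler operator *)

Section SuperInd.
Variables (C : comNzRingType) (m k : nat).
Local Notation P := (superpoly C m k).
Local Notation I := 'I_(m + k).
Local Notation z := (@spvar C m k).
Local Notation ksign := (@ksign C m k).
Implicit Types (p q : P) (S T U : {set 'I_k}) (i j l : I).

Lemma ksignC i j : ksign i j = ksign j i.
Proof. by rewrite /ksign mulnC. Qed.

Lemma ksignK i j : ksign i j * ksign i j = 1.
Proof. by rewrite -expr2 sqrr_sign. Qed.

Lemma ksignZK i j p : ksign i j *: (ksign i j *: p) = p.
Proof. by rewrite scalerA ksignK scale1r. Qed.

Lemma spvarCA i j p : z i * (z j * p) = ksign i j *: (z j * (z i * p)).
Proof.
rewrite !mulrA (spvar_supercomm C i j) /ksign -signr_odd -[in RHS]signr_odd.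
by case: odd; rewrite ?scaleN1r ?scale1r ?mulN1r ?mulNr ?mul1r ?mulrA.
Qed.

Lemma spmonom_sum p : p = \sum_S spmonom (p S) S.
Proof.
apply/ffunP => U; rewrite sum_ffunE (bigD1 U) //= ffunE eqxx big1 ?addr0 //.
by move=> S /negPf SU; rewrite ffunE eq_sym SU.
Qed.

Lemma spmonomD (c : C) (p q : {mpoly C[m]}) S :
  spmonom (c *: p + q) S = c *: spmonom p S + spmonom q S.
Proof.
apply/ffunP => U; rewrite spaddE spscaleE !ffunE.
by case: eqP; rewrite // scaler0 addr0.
Qed.

Lemma spmonom0 S : spmonom 0 S = 0 :> P.
Proof. by apply/ffunP => U; rewrite sp0E ffunE; case: eqP. Qed.

Lemma spmonom1 : spmonom 1 set0 = 1 :> P.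
Proof.
have -> : 1 = [ffun S : {set _} => (S == set0)%:R] :> P by [].
by apply/ffunP => U; rewrite !ffunE; case: eqP.
Qed.

Lemma scale_sign n (x : {mpoly C[m]}) : (-1) ^+ n *: x = (-1) ^+ n * x.
Proof.
by rewrite -[in LHS]signr_odd -[in RHS]signr_odd scaler_sign mulr_sign.
Qed.

Lemma spmonom_lin_ind (Q : P -> Prop) :
    Q 0 -> (forall (c : C) p q, Q p -> Q q -> Q (c *: p + q)) ->
    (forall a S, Q (spmonom 'X_[a] S)) ->
  forall p, Q p.
Proof.
move=> Q0 Qlin Qm p; rewrite (spmonom_sum p).
apply: (big_ind Q) => // [x y Qx Qy | S _].
  by rewrite -[x]scale1r; apply: Qlin.
elim/mpolyind: (p S) => [|c a r _ _ IH]; first by rewrite spmonom0.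
by rewrite spmonomD; apply: Qlin.
Qed.

(** Words in the variables span, so a linear property only has to survive one more left factor z_i;
    no bookkeeping of monomials is left to the applications. *)
Lemma sp_ind (Q : P -> Prop) :
    Q 1 -> (forall (c : C) p q, Q p -> Q q -> Q (c *: p + q)) ->
    (forall i p, Q p -> Q (z i * p)) ->
  forall p, Q p.
Proof.
move=> Q1 Qlin Qz.
have Q0 : Q 0 by rewrite -(addNr 1) -scaleN1r; apply: Qlin.
apply: spmonom_lin_ind => // a S.
(* Induction on the total degree. An even variable is split off when S is empty; otherwise an odd
   one is, at the cost of a sign. *)
move: {2}(mdeg a + #|S|)%N (erefl (mdeg a + #|S|)%N) => d.
elim: d a S => [|d IH] a S.
  move/eqP; rewrite addn_eq0 mdeg_eq0 cards_eq0 => /andP[/eqP-> /eqP->].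
  by rewrite mpolyX0 spmonom1.
move=> dE; case: (eqVneq S set0) => [S0|/set0Pn[b bS]].
  have: a != 0%MM by rewrite -mdeg_eq0; move: dE; rewrite S0 cards0 addn0 => ->.
  rewrite -mdeg_eq0 mdegE sum_nat_eq0 negb_forall => /existsP[i /= ai].
  have ea : a = (U_(i) + (a - U_(i)))%MM.
    rewrite addmC submK //; apply/mnm_lepP => l; rewrite mnm1E.
    by case: eqP => // <-; rewrite lt0n.
  have -> : spmonom 'X_[a] S = z (lshift k i) * spmonom 'X_[a - U_(i)] S.
    rewrite /spvar split_lshift spmonomM disjoints_subset sub0set.
    by rewrite inversions0l mul1r -mpolyXD -ea set0U.
  by apply/Qz/IH; move: dE; rewrite [in LHS]ea mdegD mdeg1; lia.
have -> : spmonom 'X_[a] S =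
    (-1) ^+ below S b *: (z (rshift m b) * spmonom 'X_[a] (S :\ b)).
  apply/ffunP => U; rewrite spscaleE spvar_oddM !ffunE.
  case: (eqVneq U S) => [->|US].
    by rewrite bS !eqxx scale_sign mulrA -expr2 sqrr_sign mul1r.
  case: ifP => bU; rewrite ?scaler0 //.
  case: eqP => [e|]; rewrite ?mulr0 ?scaler0 //.
  by rewrite -(setD1K bU) e setD1K // eqxx in US.
rewrite -[_ *: _]addr0; apply: Qlin => //; apply/Qz/IH.
by move: dE; rewrite [in LHS](cardsD1 b) bS; lia.
Qed.

Lemma spderiv1 i : spderiv i (1 : P) = 0.
Proof.
apply/ffunP => U; rewrite -spmonom1 sp0E; case: (shiftP i) => a.
  by rewrite spderiv_lshift ffunE; case: eqP; rewrite ?mderiv0 // mderivC.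
rewrite spderiv_rshift ffunE setU_eq0 -cards_eq0 cards1 /= mulr0.
by case: ifP.
Qed.

(** Both sides vanish on 1 and, by [weyl], pass a factor z_l in the same way. *)
Lemma spderivC i j p :
  spderiv i (spderiv j p) = ksign i j *: spderiv j (spderiv i p).
Proof.
elim/sp_ind: p => [|c p q IHp IHq|l p IH].
- by rewrite !spderiv1 !spderiv0 scaler0.
- by rewrite !(spderivD, spderivZ) IHp IHq scalerDr !scalerA mulrC.
rewrite !weyl !(spderivD, spderivZ) !weyl IH !scalerDr -!scalerAr !scalerA.
rewrite addrCA; congr (_ *: _ + (_ *: _ + _ *: _)); last by ring.
  by case: eqVneq => [->|]; rewrite ?mulr0 // ksignC.
by case: eqVneq => [->|]; rewrite ?mulr0 // ksignK mulr1.
Qed.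

(** The Euler operator written without beta; [eulerE] identifies it with [euler]. *)
Definition degop p : P := \sum_i z i * spderiv i p.

Lemma degopD p q : degop (p + q) = degop p + degop q.
Proof.
by rewrite /degop -big_split; apply: eq_bigr => i _; rewrite spderivD mulrDr.
Qed.

Lemma degopZ (c : C) p : degop (c *: p) = c *: degop p.
Proof.
rewrite /degop scaler_sumr; apply: eq_bigr => i _.
by rewrite spderivZ -scalerAr.
Qed.

Lemma degop0 : degop 0 = 0.
Proof. by rewrite /degop big1 // => i _; rewrite spderiv0 mulr0. Qed.

Lemma degop_sum (J : finType) (F : J -> P) :
  degop (\sum_j F j) = \sum_j degop (F j).
Proof. exact: (big_morph _ degopD degop0). Qed.

Lemma sum_delta (V : lmodType C) (J : finType) (i : J) (F : J -> V) :
  \sum_j (j == i)%:R *: F j = F i.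
Proof.
rewrite (bigD1 i) //= eqxx scale1r big1 ?addr0 // => j /negPf->.
by rewrite scale0r.
Qed.

Lemma degop_var i p : degop (z i * p) = z i * p + z i * degop p.
Proof.
rewrite /degop mulr_sumr -[in RHS](sum_delta i (fun j => z j * p)).
rewrite -big_split /=.
apply: eq_bigr => j _.
by rewrite weyl mulrDr -!scalerAr [in RHS]spvarCA ksignC.
Qed.

(** Moving d_i past z_j leaves an extra d_i when j = i; the Koszul signs from passing z_j and d_j
    cancel. *)
Lemma degop_deriv i p :
  degop (spderiv i p) = spderiv i (degop p) - spderiv i p.
Proof.
have dE : spderiv i p = \sum_j (j == i)%:R *: spderiv j p by rewrite sum_delta.
apply/eqP; rewrite eq_sym subr_eq addrC /degop spderiv_sum {1}dE.
rewrite -big_split /=; apply/eqP/eq_bigr => j _.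
by rewrite weyl spderivC -scalerAr ksignZK eq_sym.
Qed.

Lemma mcoeffXM_eq0 (i : 'I_m) (c : {mpoly C[m]}) (a : 'X_{1..m}) :
  a i = 0%N -> ('X_i * c)@_a = 0.
Proof.
move=> ai; apply: memN_msupp_eq0; rewrite mulrC (perm_mem (msuppMX _ _)).
by apply/mapP => -[b _ e]; move: ai; rewrite e mnmDE mnm1E eqxx.
Qed.

Lemma mcoeffXM (i : 'I_m) (c : {mpoly C[m]}) (a : 'X_{1..m}) :
  ('X_i * c)@_(a + U_(i)) = c@_a.
Proof. by rewrite mulrC addmC mcoeffMX. Qed.

(** Each even z_i d_i multiplies a monomial by its exponent, each odd one by 0 or 1. This turns
    equations for Euler eigenvectors into conditions on coefficients. *)
Lemma degopE p U (a : 'X_{1..m}) :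
  (degop p U)@_a = (mdeg a + #|U|)%:R * (p U)@_a.
Proof.
rewrite /degop sum_ffunE raddf_sum big_split_ord /= natrD mulrDl.
rewrite mdegE natr_sum mulr_suml -sum1_card natr_sum mulr_suml.
congr (_ + _).
  apply: eq_bigr => i _; rewrite spvar_evenM spderiv_lshift.
  case: (posnP (a i)) => ai; first by rewrite mcoeffXM_eq0 // ai mul0r.
  have ea : a = ((a - U_(i)) + U_(i))%MM.
    rewrite submK //; apply/mnm_lepP => l; rewrite mnm1E.
    by case: eqP => // <-.
  rewrite [in LHS]ea mcoeffXM mcoeff_deriv -ea mnmBE mnm1E eqxx.
  by rewrite subn1 prednK // mulr_natl.
rewrite [RHS]big_mkcond; apply: eq_bigr => b _ /=.
rewrite spvar_oddM; case: ifP => bU; last by rewrite mcoeff0.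
rewrite spderiv_rshift setD11 setD1K // (belowD1 _ bU) ltnn mulrA -expr2.
by rewrite sqrr_sign !mul1r.
Qed.

End SuperInd.

(** * R^2, its Laplacian and the Bessel operators for a signed permutation matrix beta *)

Section Quadratic.
Variables (C : comNzRingType) (m k : nat).
Local Notation P := (superpoly C m k).
Local Notation I := 'I_(m + k).
Local Notation z := (@spvar C m k).
Local Notation d := (@spderiv C m k).
Local Notation ksign := (@ksign C m k).
Variables (dual : I -> I) (s : I -> C).
Hypothesis dualK : involutive dual.
Hypothesis parity_dual : forall i, parity (dual i) = parity i.
Hypothesis s2 : forall i, s i * s i = 1.
(** Supersymmetry of the form: beta is symmetric on even indices and antisymmetric on odd ones. *)
Hypothesis s_dual : forall i, s (dual i) = ksign i i * s i.
Implicit Types (p q : P) (i j l : I).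

Lemma ksign_duall i j : ksign (dual i) j = ksign i j.
Proof. by rewrite /ksign parity_dual. Qed.

Lemma ksign_dualr i j : ksign i (dual j) = ksign i j.
Proof. by rewrite /ksign parity_dual. Qed.

(* With beta_(i j) = s_i [j = dual i], these are R^2, Delta and \partial_i; the
   double sums over beta^(i j) collapse because the inverse of beta is its
   transpose. *)
Definition quad : P := \sum_j s j *: (z (dual j) * z j).
Definition quad_lap p : P := \sum_j s j *: d (dual j) (d j p).
Definition lower i p : P := s i *: d (dual i) p.

Lemma quadM p : quad * p = \sum_j s j *: (z (dual j) * (z j * p)).
Proof.
rewrite /quad mulr_suml; apply: eq_bigr => j _.
by rewrite -scalerAl mulrA.
Qed.

Lemma var_quad i p : z i * (quad * p) = quad * (z i * p).
Proof.
rewrite !quadM mulr_sumr; apply: eq_bigr => j _.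
by rewrite -scalerAr (spvarCA i) (spvarCA i) -scalerAr ksign_dualr ksignZK.
Qed.

(** d_i hits z_(dual j) for j = dual i, and z_j for j = i. By supersymmetry the two contributions
    agree, whence the factor 2. *)
Lemma deriv_quad i p :
  d i (quad * p) = (2 * s (dual i)) *: (z (dual i) * p) + quad * d i p.
Proof.
have -> : (2 * s (dual i)) *: (z (dual i) * p) =
    \sum_j (j == i)%:R *: (s (dual j) *: (z (dual j) * p)) +
    \sum_j (j == dual i)%:R *: (s j *: (z j * p)).
  by rewrite !sum_delta -scalerDl -mulr2n mulr_natl.
rewrite !quadM spderiv_sum -!big_split /=; apply: eq_bigr => j _.
rewrite spderivZ !weyl mulrDr -!scalerAr !scalerDr !scalerA.
have e1 : s j * (i == dual j)%:R = (j == dual i)%:R * s j.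
  by rewrite mulrC eq_sym (can2_eq dualK dualK).
have e2 : s j * ksign i (dual j) * (i == j)%:R = (j == i)%:R * s (dual j).
  rewrite ksign_dualr s_dual; case: (eqVneq i j) => [->|_].
    by rewrite mulr1 mul1r mulrC.
  by rewrite mulr0 mul0r.
have e3 : s j * ksign i (dual j) * ksign i j = s j.
  by rewrite ksign_dualr -mulrA ksignK mulr1.
by rewrite e1 e2 e3 addrCA addrA.
Qed.

Lemma degop_quad p : degop (quad * p) = 2 *: (quad * p) + quad * degop p.
Proof.
rewrite scaler_nat mulr2n !quadM degop_sum -!big_split /=.
by apply: eq_bigr => j _; rewrite degopZ !degop_var mulrDr !scalerDr addrA.
Qed.

Lemma quad_lapD p q : quad_lap (p + q) = quad_lap p + quad_lap q.
Proof.
rewrite /quad_lap -big_split; apply: eq_bigr => j _ /=.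
by rewrite !spderivD scalerDr.
Qed.

Lemma quad_lapZ (c : C) p : quad_lap (c *: p) = c *: quad_lap p.
Proof.
rewrite /quad_lap scaler_sumr; apply: eq_bigr => j _.
by rewrite !spderivZ !scalerA mulrC.
Qed.

(** The sl_2 relation [Delta, R^2] = 4 E + 2 M, where M, the sum of the [ksign j j], is the number
    of even indices minus that of odd ones. *)
Lemma quad_lap_quad p : quad_lap (quad * p) =
  ((\sum_j ksign j j) *: p) *+ 2 + degop p *+ 4 + quad * quad_lap p.
Proof.
have dE : degop p = \sum_j z (dual j) * d (dual j) p.
  rewrite [RHS](reindex_inj (can_inj dualK)) /=.
  by under eq_bigr do rewrite dualK.
rewrite (mulrnDr _ 2 2) {1}dE /degop scaler_suml -!sumrMnl.
rewrite mulr_sumr -!big_split /=.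
apply: eq_bigr => j _.
rewrite deriv_quad spderivD spderivZ deriv_quad weyl.
have e1 : s j * (2 * s (dual j)) = ksign j j *+ 2.
  by rewrite mulrCA s_dual [s j * _]mulrCA s2 mulr1 mulr_natl.
rewrite dualK eqxx scale1r -/(ksign _ _).
rewrite !scalerDr !scalerA e1 mulrCA s2 mulr1 scaler_nat !scalerMnl.
rewrite ksign_duall ksign_dualr.
by rewrite mulrnAl ksignK -[(1 *+ 2) *: _]scalerMnl scale1r -scalerAr !addrA.
Qed.

Lemma quad_lap_deriv i p : quad_lap (d i p) = d i (quad_lap p).
Proof.
rewrite /quad_lap spderiv_sum; apply: eq_bigr => j _.
rewrite spderivZ [d i (d _ _)]spderivC [d i (d j p)]spderivC !spderivZ.
by rewrite ksign_dualr ksignZK.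
Qed.

Lemma spoppE p (U : {set 'I_k}) : (- p) U = - p U.
Proof. exact: ffunE. Qed.

Lemma spmulrnE p n (U : {set 'I_k}) : (p *+ n) U = p U *+ n.
Proof. by elim: n => [|n IH]; rewrite ?sp0E // !mulrS spaddE IH. Qed.

Lemma degop_quad_lap p :
  degop (quad_lap p) = quad_lap (degop p) - quad_lap p *+ 2.
Proof.
rewrite /quad_lap degop_sum -sumrMnl -sumrB; apply: eq_bigr => j _.
rewrite degopZ !degop_deriv !spderivD !spderivN !scalerDr !scalerN mulr2n.
by rewrite opprD addrA.
Qed.

Lemma lowerZ i (c : C) p : lower i (c *: p) = c *: lower i p.
Proof. by rewrite /lower spderivZ !scalerA mulrC. Qed.

Lemma quad_lap_lower i p : quad_lap (lower i p) = lower i (quad_lap p).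
Proof. by rewrite /lower quad_lapZ quad_lap_deriv. Qed.

Lemma degop_lower i p : degop (lower i p) = lower i (degop p) - lower i p.
Proof. by rewrite /lower degopZ degop_deriv scalerDr scalerN. Qed.

Lemma lower_quad i p : lower i (quad * p) = z i * p *+ 2 + quad * lower i p.
Proof.
rewrite /lower deriv_quad dualK scalerDr scalerA mulrCA s2 mulr1 scaler_nat.
by rewrite -scalerAr.
Qed.

Definition bess (M : C) i p : P :=
  (M - 2) *: lower i p + degop (lower i p) *+ 2 - z i * quad_lap p.

Lemma lowerD i p q : lower i (p + q) = lower i p + lower i q.
Proof. by rewrite /lower spderivD scalerDr. Qed.

Lemma bessZ (M c : C) i p : bess M i (c *: p) = c *: bess M i p.
Proof.
rewrite /bess lowerZ quad_lapZ degopZ -scalerAr -!scaler_nat.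
by rewrite !(scalerA _ c) !(mulrC _ c) -!scalerA -scalerDr -scalerBr.
Qed.

Lemma bessD (M : C) i p q : bess M i (p + q) = bess M i p + bess M i q.
Proof.
rewrite /bess lowerD quad_lapD degopD mulrDr.
move: (lower i p) (lower i q) (z i * _) (z i * _) => u v x y.
move: (degop u) (degop v) => u' v'.
(* The identity is linear over [C], so it is compared coefficientwise, where [ring] applies. *)
apply/ffunP => U; apply/mpolyP => a.
rewrite !(spaddE, spscaleE, spoppE, spmulrnE).
rewrite !(mcoeffD, mcoeffN, mcoeffZ, mcoeffMn).
ring.
Qed.

(** The terms in z_i p and z_i E p cancel because the parameter of [bess] is the superdimension,
    here as a sum of signs. Hence the Bessel operators preserve the multiples of R^2. *)
Lemma bess_quad i p : bess (\sum_j ksign j j) i (quad * p) =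
  quad * (bess (\sum_j ksign j j) i p + lower i p *+ 4).
Proof.
rewrite /bess lower_quad quad_lap_quad degopD degop_quad mulr2n degopD -mulr2n.
rewrite degop_var scaler_nat.
set M := \sum_j _; set L := lower i p; rewrite !mulrDr var_quad -!scalerAr.
rewrite mulrN.
have -> : s i *: (quad * d (dual i) p) = quad * L by rewrite -scalerAr.
move: (z i * p) (z i * degop p) (quad * L) (quad * degop L).
move: (quad * (z i * _)) => f a b c e.
apply/ffunP => U; apply/mpolyP => x.
rewrite !(spaddE, spscaleE, spoppE, spmulrnE).
rewrite !(mcoeffD, mcoeffN, mcoeffZ, mcoeffMn).
ring.
Qed.

End Quadratic.

(** * Substitution of supercommuting operators for the variables *)

Section MonomialOperators.
Variables (C : comNzRingType) (m k : nat) (V : lmodType C).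
Local Notation P := (superpoly C m k).
Local Notation I := 'I_(m + k).
Local Notation z := (@spvar C m k).
Local Notation ksign := (@ksign C m k).
Variable T : I -> V -> V.
Hypothesis TD : forall i, {morph T i : u v / u + v}.
Hypothesis TZ : forall i (c : C), {morph T i : v / c *: v}.
Hypothesis TC : forall i j v, T i (T j v) = ksign i j *: T j (T i v).
Hypothesis T2 : forall b v, T (rshift m b) (T (rshift m b) v) = 0.
Implicit Types (p q : P) (S : {set 'I_k}) (i j : I) (u v : V).

Lemma op0 i : T i 0 = 0.
Proof. by have := TZ i 0 0; rewrite !scale0r. Qed.

Definition odd_op S v :=
  foldr (fun (j : 'I_k) r => T (rshift m j) r) v (enum S).

Definition even_op (a : 'X_{1..m}) v :=
  foldr (fun (i : 'I_m) r => iter (a i) (T (lshift k i)) r) v (enum 'I_m).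

Definition mono_op a S v := even_op a (odd_op S v).

(* For V = P this is convertible to subst_op. *)
Definition poly_op p v : V :=
  \sum_(S : {set 'I_k}) \sum_(a <- msupp (p S)) (p S)@_a *: mono_op a S v.

Lemma opC_even (i : 'I_m) j v : T j (T (lshift k i) v) = T (lshift k i) (T j v).
Proof. by rewrite TC /ksign parity_lshift muln0 scale1r. Qed.

Lemma op_iter_even (i : 'I_m) j r v :
  T j (iter r (T (lshift k i)) v) = iter r (T (lshift k i)) (T j v).
Proof. by elim: r => //= r IH; rewrite opC_even IH. Qed.

Lemma op_even_op j a v : T j (even_op a v) = even_op a (T j v).
Proof.
rewrite /even_op; elim: (enum _) => //= i s IH.
by rewrite op_iter_even IH.
Qed.

Lemma even_opU (i : 'I_m) a v :
  T (lshift k i) (even_op a v) = even_op (a + U_(i)) v.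
Proof.
rewrite /even_op; have := mem_enum 'I_m i; have := enum_uniq 'I_m.
rewrite inE; elim: (enum _) => //= j s IH /andP[js us].
rewrite inE mnmDE mnm1E; case: eqVneq js => [<- js _|ij _ /= si]; last first.
  by rewrite addn0 op_iter_even IH.
rewrite addn1 /=; congr (T _ (iter _ _ _)).
elim: s {IH us} js => //= l s IH.
rewrite inE negb_or => /andP[il /IH->]; rewrite mnmDE mnm1E.
by rewrite (negPf il) addn0.
Qed.

(** Folding over all indices lets [S] and [b |: S] be compared along the same list. *)
Lemma odd_op_enum S v : odd_op S v =
  foldr (fun (j : 'I_k) r => if j \in S then T (rshift m j) r else r)
    v (enum 'I_k).
Proof.
rewrite /odd_op [enum (mem S)]/enum_mem -enumT.
by elim: (enum _) => //= j s <-; case: ifP.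
Qed.

(** T_b supercommutes up to its own occurrence, where [T2] gives 0. *)
Lemma op_odd_op_mem S b v : b \in S -> T (rshift m b) (odd_op S v) = 0.
Proof.
move=> bS; rewrite odd_op_enum; have := mem_enum 'I_k b; rewrite inE.
elim: (enum _) => //= j s IH; rewrite inE; case: eqVneq => [<- _|bj /= bs].
  by rewrite bS T2.
by case: ifP => _; [rewrite TC IH // op0 scaler0 | apply: IH].
Qed.

(** T_b moves past the operators of smaller index in S to its place in the increasing order; each
    passage costs a sign. *)
Lemma op_odd_op S b v : b \notin S ->
  T (rshift m b) (odd_op S v) = (-1) ^+ below S b *: odd_op (b |: S) v.
Proof.
move=> bS; rewrite !odd_op_enum.
have -> : below S b =
    count (fun t : 'I_k => (t \in S) && (t < b)%N) (enum 'I_k).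
  rewrite /below big_mkcond -sum1_count big_enum_cond [RHS]big_mkcond /=.
  by apply: eq_bigr => t _; case: (t \in S); case: ltnP.
have := mem_enum 'I_k b; rewrite inE.
have : sorted (fun x y : 'I_k => (x < y)%N) (enum 'I_k).
  by have := iota_ltn_sorted 0 k; rewrite -val_enum_ord sorted_map.
elim: (enum _) => //= j s IH pjs; rewrite inE.
have lt_tr : transitive (fun x y : 'I_k => (x < y)%N).
  by move=> ? ? ?; apply: ltn_trans.
have /allP jlt := order_path_min lt_tr pjs.
rewrite !inE; case: eqVneq jlt => [<- jlt _|bj jlt /= bs].
  rewrite (negPf bS) (@eq_in_count _ _ pred0) ?count_pred0 ?scale1r; last first.
    by move=> t /jlt /= bt; rewrite [(t < b)%N]ltnNge (ltnW bt) andbF.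
  (* All later entries of the sorted list exceed b, so the two membership tests agree there. *)
  rewrite /=; congr (T _ _).
  elim: s jlt {IH pjs} => //= t s IH tlt; rewrite !inE.
  rewrite IH => [|x xs]; last by apply: tlt; rewrite inE xs orbT.
  by have := tlt t (mem_head _ _); case: eqVneq => [->|//]; rewrite ltnn.
have {}IH := IH (path_sorted pjs) bs; rewrite exprD.
have -> : (j < b)%N = true by apply: jlt.
rewrite andbT; case: ifP => jS; last by rewrite mul1r.
by rewrite TC IH TZ scalerA /ksign !parity_rshift.
Qed.

Lemma even_opZ a (c : C) v : even_op a (c *: v) = c *: even_op a v.
Proof.
rewrite /even_op; elim: (enum _) => //= i s ->.
by elim: (a i) => //= r ->; rewrite TZ.
Qed.

Lemma even_op0 a : even_op a 0 = 0.
Proof. by have := even_opZ a 0 0; rewrite !scale0r. Qed.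

Lemma even_opD a u v : even_op a (u + v) = even_op a u + even_op a v.
Proof.
rewrite /even_op; elim: (enum _) => //= i s ->.
by elim: (a i) => //= r ->; rewrite TD.
Qed.

Lemma mono_opD a S u v : mono_op a S (u + v) = mono_op a S u + mono_op a S v.
Proof.
rewrite /mono_op -even_opD; congr even_op; rewrite /odd_op.
by elim: (enum _) => //= b s ->; rewrite TD.
Qed.

Lemma op_mono_even (i : 'I_m) a S v :
  T (lshift k i) (mono_op a S v) = mono_op (a + U_(i)) S v.
Proof. exact: even_opU. Qed.

Lemma op_mono_odd b a S v : T (rshift m b) (mono_op a S v) =
  if b \in S then 0 else (-1) ^+ below S b *: mono_op a (b |: S) v.
Proof.
rewrite /mono_op op_even_op; case: ifPn => bS.
  by rewrite op_odd_op_mem // even_op0.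
by rewrite op_odd_op // even_opZ.
Qed.

Lemma poly_opDr p u v : poly_op p (u + v) = poly_op p u + poly_op p v.
Proof.
rewrite /poly_op -big_split; apply: eq_bigr => S _ /=.
by rewrite -big_split; apply: eq_bigr => a _; rewrite mono_opD scalerDr.
Qed.

Lemma sum_msupp (W : lmodType C) (c : {mpoly C[m]}) (s : seq 'X_{1..m})
    (F : 'X_{1..m} -> W) : uniq s -> {subset msupp c <= s} ->
  \sum_(a <- msupp c) c@_a *: F a = \sum_(a <- s) c@_a *: F a.
Proof.
move=> us cs; rewrite [RHS](bigID (mem (msupp c))) /= [X in _ + X]big1 ?addr0.
  rewrite -[RHS]big_filter; apply: perm_big; apply: uniq_perm => //.
    exact: filter_uniq.
  by move=> a; rewrite mem_filter; case: (boolP (a \in msupp c)) => [/cs->|].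
by move=> a ac; rewrite memN_msupp_eq0 // scale0r.
Qed.

Lemma poly_opP (c : C) p q v :
  poly_op (c *: p + q) v = c *: poly_op p v + poly_op q v.
Proof.
rewrite /poly_op scaler_sumr -big_split; apply: eq_bigr => S _ /=.
(* The supports differ, so the three sums are moved to one list containing them all. *)
pose s := undup (msupp (p S) ++ msupp (q S) ++ msupp ((c *: p + q) S)).
rewrite !(@sum_msupp _ _ s) ?undup_uniq // => [|x xs|x xs|x xs];
  do ?by rewrite mem_undup !mem_cat xs ?orbT.
rewrite scaler_sumr -big_split; apply: eq_bigr => a _ /=.
by rewrite spaddE spscaleE mcoeffD mcoeffZ scalerDl scalerA.
Qed.

Lemma poly_op0 v : poly_op 0 v = 0.
Proof.
rewrite /poly_op big1 // => S _.
by rewrite sp0E msupp0 big_nil.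
Qed.

Lemma poly_opD p q v : poly_op (p + q) v = poly_op p v + poly_op q v.
Proof. by rewrite -[p in LHS]scale1r poly_opP scale1r. Qed.

Lemma poly_opZ (c : C) p v : poly_op (c *: p) v = c *: poly_op p v.
Proof. by rewrite -[_ *: p]addr0 poly_opP poly_op0 addr0. Qed.

Lemma poly_op_spmonom a S v : poly_op (spmonom 'X_[a] S) v = mono_op a S v.
Proof.
rewrite /poly_op (bigD1 S) //= [X in _ + X]big1 ?addr0.
  by rewrite ffunE eqxx msuppX big_seq1 mcoeffX eqxx scale1r.
by move=> U /negPf US; rewrite ffunE US msupp0 big_nil.
Qed.

(** The T_i satisfy the relations of the z_i, so a new left factor is sorted into the fixed order of
    [mono_op] with the same sign as in the ring. *)
Lemma poly_op_var i p v : poly_op (z i * p) v = T i (poly_op p v).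
Proof.
elim/spmonom_lin_ind: p => [|c p q IHp IHq|a S].
- by rewrite mulr0 poly_op0 op0.
- by rewrite mulrDr -scalerAr !poly_opP IHp IHq TD TZ.
rewrite poly_op_spmonom; case: (shiftP i) => b.
  rewrite op_mono_even -poly_op_spmonom; congr poly_op.
  apply/ffunP => U; rewrite spvar_evenM !ffunE; case: eqP; rewrite ?mulr0 //.
  by rewrite -mpolyXD addmC.
rewrite op_mono_odd; case: ifPn => bS.
  rewrite -(poly_op0 v); congr poly_op.
  apply/ffunP => U; rewrite spvar_oddM sp0E ffunE; case: ifP => // bU.
  by case: eqP => [e|]; rewrite ?mulr0 //; rewrite -e !inE eqxx in bS.
rewrite -poly_op_spmonom -[RHS]addr0 -(poly_op0 v) -poly_opP; congr poly_op.
apply/ffunP => U; rewrite addr0 spvar_oddM spscaleE !ffunE.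
case: (eqVneq U (b |: S)) => [->|US].
  by rewrite setU11 setU1K // eqxx belowU1 // ltnn scale_sign.
rewrite scaler0; case: ifP => // bU; case: eqP => [e|]; rewrite ?mulr0 //.
by rewrite -e setD1K ?eqxx in US.
Qed.

Lemma poly_op1 v : poly_op 1 v = v.
Proof.
rewrite -spmonom1 -mpolyX0 poly_op_spmonom /mono_op /odd_op /even_op enum_set0.
by elim: (enum _) => //= i s ->; rewrite mnm0E.
Qed.

Lemma poly_opM p q v : poly_op (p * q) v = poly_op p (poly_op q v).
Proof.
elim/sp_ind: p => [|c p r IHp IHr|i p IH].
- by rewrite mul1r poly_op1.
- by rewrite mulrDl -scalerAl !poly_opP IHp IHr.
by rewrite -mulrA !poly_op_var IH.
Qed.

End MonomialOperators.

(** * The Fischer pairing by signed derivatives *)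

Section Nondegenerate.
Variables (C : numFieldType) (m k : nat).
Local Notation P := (superpoly C m k).
Local Notation I := 'I_(m + k).
Local Notation z := (@spvar C m k).
Local Notation d := (@spderiv C m k).
Local Notation ksign := (@ksign C m k).
Variables (dual : I -> I) (delta : 'I_k -> 'I_k) (s t : I -> C).
Hypothesis dualK : involutive dual.
Hypothesis dual_even : forall a, dual (lshift k a) = lshift k a.
Hypothesis dual_odd : forall b, dual (rshift m b) = rshift m (delta b).
Hypothesis s2 : forall i, s i * s i = 1.
Hypothesis s_dual : forall i, s (dual i) = ksign i i * s i.
Hypothesis t_neq0 : forall i, t i != 0.
(** The signs [t] may differ from [s], but not in the product over a dual pair, which is all that
    Delta sees. *)
Hypothesis tt_dual : forall i, t (dual i) * t i = s (dual i) * s i.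
Variable a0 : 'I_m.
Local Notation i0 := (lshift k a0 : I).
Hypothesis s_i0 : s i0 = -1.
Local Notation quad := (quad dual s).
Local Notation quad_lap := (quad_lap dual s).
Implicit Types (p q : P) (S : {set 'I_k}) (i j : I).

Lemma dual_parity i : parity (dual i) = parity i.
Proof.
by case: (shiftP i) => a; rewrite ?dual_even // dual_odd !parity_rshift.
Qed.

Definition tlow i p : P := t i *: d (dual i) p.

Lemma spderiv_odd2 b p : d (rshift m b) (d (rshift m b) p) = 0.
Proof.
apply/ffunP => U; rewrite sp0E !spderiv_rshift setU11 mulr0.
by case: ifP.
Qed.

Lemma tlowD i : {morph tlow i : p q / p + q}.
Proof. by move=> p q; rewrite /tlow spderivD scalerDr. Qed.

Lemma tlowZ i (c : C) : {morph tlow i : p / c *: p}.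
Proof. by move=> p; rewrite /tlow spderivZ !scalerA mulrC. Qed.

Lemma tlowC i j p : tlow i (tlow j p) = ksign i j *: tlow j (tlow i p).
Proof.
rewrite /tlow !spderivZ spderivC !scalerA /ksign !dual_parity.
by rewrite mulrA mulrC (mulrC (t i)) mulrA.
Qed.

Lemma tlow2 b p : tlow (rshift m b) (tlow (rshift m b) p) = 0.
Proof. by rewrite /tlow spderivZ dual_odd spderiv_odd2 !scaler0. Qed.

Local Notation mono_op := (mono_op tlow).
Local Notation poly_op := (poly_op tlow).

Let poly_op_var := poly_op_var tlowD tlowZ tlowC tlow2.
Let poly_opM := poly_opM tlowD tlowZ tlowC tlow2.

(** Together with [poly_opM] this is the adjointness of multiplication by R^2 and Delta; the signs
    match by [tt_dual]. *)
Lemma poly_op_quad p : poly_op quad p = quad_lap p.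
Proof.
have sumE (J : Type) (r : seq J) (F : J -> P) :
    poly_op (\sum_(j <- r) F j) p = \sum_(j <- r) poly_op (F j) p.
  elim: r => [|j r IH].
    by rewrite !big_nil poly_op0.
  by rewrite !big_cons poly_opD IH.
rewrite /quad sumE /quad_lap [RHS](reindex_inj (can_inj dualK)) /=.
apply: eq_bigr => j _; rewrite dualK poly_opZ.
rewrite poly_op_var -[z j]mulr1 poly_op_var poly_op1 /tlow spderivZ dualK.
by rewrite !scalerA -mulrA tt_dual mulrCA s2 mulr1.
Qed.

(** The constant is the r-th power of [t (lshift k i)] times (x + 1) ... (x + r), nonzero in
    characteristic 0. It depends on b only through the exponent x. *)
Lemma iter_tlow_coef (i : 'I_m) (r x : nat) :
  exists2 u : C, u != 0 & forall q (U : {set 'I_k}) (b : 'X_{1..m}), b i = x ->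
    (iter r (tlow (lshift k i)) q U)@_b = u * (q U)@_(b + U_(i) *+ r).
Proof.
elim: r x => [|r IH] x.
  exists 1 => [|q U b _]; first exact: oner_neq0.
  by rewrite mulm0n addm0 mul1r.
have [u u0 uE] := IH x.+1.
exists (t (lshift k i) * x.+1%:R * u).
  by rewrite !mulf_neq0 // pnatr_eq0.
move=> q U b bx; rewrite iterS; set w := iter r _ q.
rewrite /tlow dual_even spscaleE spderiv_lshift mcoeffZ mcoeff_deriv.
rewrite {}/w uE; last by rewrite mnmDE mnm1E eqxx bx addn1.
have -> : (b + U_(i) *+ r.+1 = b + U_(i) + U_(i) *+ r)%MM.
  by rewrite mulmS addmA.
by rewrite bx -!mulrA mulr_natl.
Qed.

Lemma even_op_coef (a : 'X_{1..m}) : exists2 u : C, u != 0 &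
  forall q (U : {set 'I_k}), (even_op tlow a q U)@_0%MM = u * (q U)@_a.
Proof.
(* Requiring b to vanish on l puts each new variable at exponent 0, so one constant serves all b. *)
have H (l : seq 'I_m) : uniq l -> exists2 u : C, u != 0 &
    forall q (U : {set 'I_k}) (b : 'X_{1..m}),
      (forall e : 'I_m, e \in l -> b e = 0%N) ->
    ((foldr (fun (i : 'I_m) r => iter (a i) (tlow (lshift k i)) r) q l : P)
       U)@_b
      = u * (q U)@_[multinom (b e + (e \in l) * a e)%N | e < m].
  elim: l => [_|i l IH /= /andP[il ul]].
    exists 1 => [|q U b _]; first exact: oner_neq0.
    rewrite mul1r; congr (_ @_ _); apply/mnmP => i.
    by rewrite mnmE addn0.
  have [u u0 uE] := IH ul; have [v v0 vE] := iter_tlow_coef i (a i) 0.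
  exists (v * u); first exact: mulf_neq0.
  move=> q U b bl; rewrite vE; last by rewrite bl ?mem_head.
  rewrite uE => [|j jl]; last first.
    rewrite mnmDE bl ?inE ?jl ?orbT // mulmnE mnm1E.
    by case: eqVneq jl il => [->->|].
  rewrite mulrA; congr (_ * mcoeff _ _); apply/mnmP => j.
  rewrite !mnmE mulmnE mnm1E inE.
  case: (eqVneq i j) => [<-|ij].
    by rewrite (negPf il) bl ?mem_head //=; lia.
  by rewrite /=; lia.
have [u u0 uE] := H _ (enum_uniq 'I_m).
exists u => // q U; rewrite /even_op uE => [|i _]; last by rewrite mnm0E.
congr (_ * mcoeff _ _); apply/mnmP => i.
by rewrite mnmE mnm0E mem_enum mul1n.
Qed.

Lemma delta_inj : injective delta.
Proof.
move=> b c e; apply: (@rshift_inj m); apply: (can_inj dualK).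
by rewrite !dual_odd e.
Qed.

(** At an odd index b, [tlow] differentiates in the variable of index [delta b]; this is how
    [delta @: S] arises. *)
Lemma odd_op_coef S : exists2 u : C, u != 0 &
  forall q, (odd_op tlow S q) set0 = u *: q (delta @: S).
Proof.
have H (l : seq 'I_k) : uniq l -> forall U : {set 'I_k},
    (forall b, b \in l -> delta b \notin U) -> exists2 u : C, u != 0 &
    forall q, (foldr (fun (j : 'I_k) r => tlow (rshift m j) r) q l : P) U
      = u *: q (U :|: [set x in map delta l]).
  elim: l => [_ U _|b l IH /= /andP[bl ul] U Ub].
    exists 1 => [|q]; first exact: oner_neq0.
    rewrite scale1r; congr (q _).
    by apply/setP => x; rewrite !inE orbF.
  have [c cl|u u0 uE] := IH ul (delta b |: U).
    rewrite !inE negb_or Ub ?inE ?cl ?orbT // andbT.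
    by apply: contraNneq bl => /delta_inj <-.
  exists (t (rshift m b) * (-1) ^+ below U (delta b) * u).
    by rewrite !mulf_neq0 // signr_eq0.
  move=> q; rewrite /tlow dual_odd spscaleE spderiv_rshift.
  rewrite (negPf (Ub _ (mem_head _ _))) -/tlow uE -scale_sign !scalerA.
  congr (_ *: q _); apply/setP => x; rewrite !inE.
  by rewrite orbCA orbA.
have [||u u0 uE] := H (enum S) _ set0; first exact: enum_uniq.
  by move=> b _; rewrite inE.
exists u => // q; rewrite uE set0U; congr (_ *: q _).
apply/setP => x; rewrite inE; apply/mapP/imsetP => -[y yS ->]; exists y => //.
  by rewrite -mem_enum.
by rewrite mem_enum.
Qed.

(** On monomials the Fischer pairing is a permutation matrix with nonzero weights: z^a theta_S is
    dual to z^a theta_T with T = [delta @: S]. *)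
Lemma mono_op_coef a S : exists2 u : C, u != 0 &
  forall q, (mono_op a S q set0)@_0%MM = u * (q (delta @: S))@_a.
Proof.
have [u u0 uE] := even_op_coef a; have [v v0 vE] := odd_op_coef S.
exists (u * v); first exact: mulf_neq0.
by move=> q; rewrite uE vE mcoeffZ mulrA.
Qed.

Lemma quad_comm p : p * quad = quad * p.
Proof.
elim/sp_ind: p => [|c p q IHp IHq|i p IH]; first by rewrite mul1r mulr1.
  by rewrite mulrDl mulrDr -scalerAl -scalerAr IHp IHq.
by rewrite -mulrA IH (var_quad _ dual_parity).
Qed.

(** * Division by R^2 and the part of Delta transversal to z_0 *)

Local Notation z0 := (z i0).
Local Notation d0 := (d i0).

Lemma deriv_z0 j p : d j (z0 * p) = (j == i0)%:R *: p + z0 * d j p.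
Proof. by rewrite weyl /ksign parity_lshift muln0 scale1r. Qed.

Lemma d0_z0 p : d0 (z0 * p) = p + z0 * d0 p.
Proof. by rewrite deriv_z0 eqxx scale1r. Qed.

Lemma d0_var j p : j != i0 -> d0 (z j * p) = z j * d0 p.
Proof.
move=> /negPf ji; rewrite weyl eq_sym ji scale0r add0r.
by rewrite /ksign parity_lshift scale1r.
Qed.

(** The condition [d0 (d0 q) = 0] bounds the degree of q in z_0 by 1. Only a factor z_0 can break
    it, and the term -z_0^2 of R^2 repairs it. *)
Lemma division_quad p : exists r q, p = r * quad + q /\ d0 (d0 q) = 0.
Proof.
elim/sp_ind: p
  => [|c p1 p2 [r1 [q1 [e1 h1]]] [r2 [q2 [e2 h2]]]|i p [r [q [e h]]]].
- by exists 0, 1; rewrite mul0r add0r !spderiv1 spderiv0.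
- exists (c *: r1 + r2), (c *: q1 + q2); split.
    by rewrite e1 e2 scalerDr mulrDl scalerAl addrACA.
  by rewrite !(spderivD, spderivZ) h1 h2 scaler0 addr0.
case: (eqVneq i i0) => [->|ii0].
  (* The part of z_0 q that is quadratic in z_0 is z_0^2 d_0 q; adding R^2 d_0 q removes it, and the
     quotient is corrected by - d_0 q. *)
  exists (z0 * r - d0 q), (z0 * q + quad * d0 q); split.
    rewrite e mulrDr mulrBl mulrA quad_comm [d0 q * _]quad_comm addrACA.
    by rewrite addrA addrNK.
  rewrite spderivD (deriv_quad dualK dual_parity s_dual) dual_even s_i0 h.
  rewrite mulr0 addr0 d0_z0 !spderivD spderivZ !d0_z0 h !mulr0 !addr0.
  by rewrite mulrN1 scaleNr scaler_nat mulr2n subrr.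
exists (z i * r), (z i * q); split; first by rewrite e mulrDr mulrA.
by rewrite !d0_var // h mulr0.
Qed.

(* As s_0 = -1, this removes the term -d_0^2 from the Laplacian. *)
Definition perp_lap p : P := quad_lap p + d0 (d0 p).

(** z_0 commutes with every derivative but d_0, and the two terms that the index i0 yields in Delta
    cancel the two from d_0^2. *)
Lemma perp_lap_z0 p : perp_lap (z0 * p) = z0 * perp_lap p.
Proof.
rewrite /perp_lap /quad_lap.
have -> : \sum_j s j *: d (dual j) (d j (z0 * p)) =
    \sum_j ((j == i0)%:R *: (s j *: d (dual j) p) +
            (j == i0)%:R *: (s j *: d j p) +
            z0 * (s j *: d (dual j) (d j p))).
  apply: eq_bigr => j _; rewrite deriv_z0 spderivD spderivZ deriv_z0.
  have sc (c e : C) q : c *: (e *: q) = e *: (c *: q) by rewrite !scalerA mulrC.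
  have -> : (dual j == i0) = (j == i0).
    by rewrite -{1}(dual_even a0) (inj_eq (can_inj dualK)).
  rewrite scalerDr scalerDr (sc (s j) _ (d (dual j) p)) (sc (s j) _ (d j p)).
  by rewrite -scalerAr addrA.
rewrite big_split big_split /=.
rewrite (sum_delta i0 (fun j => s j *: d (dual j) p)).
rewrite (sum_delta i0 (fun j => s j *: d j p)).
rewrite dual_even s_i0 -mulr_sumr.
rewrite d0_z0 spderivD d0_z0 mulrDr scaleN1r.
by rewrite -opprD [d0 p + (d0 p + _)]addrA addrACA addNr add0r.
Qed.

Lemma perp_lapZ (c : C) p : perp_lap (c *: p) = c *: perp_lap p.
Proof. by rewrite /perp_lap quad_lapZ !spderivZ scalerDr. Qed.

Lemma quad_lapE p : quad_lap p = perp_lap p - d0 (d0 p).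
Proof. by rewrite /perp_lap addrK. Qed.

Lemma d0_perp_lap p : d0 (perp_lap p) = perp_lap (d0 p).
Proof. by rewrite /perp_lap spderivD (quad_lap_deriv _ dual_parity). Qed.

Lemma degop_perp_lap p :
  degop (perp_lap p) = perp_lap (degop p) - perp_lap p *+ 2.
Proof.
rewrite /perp_lap degopD degop_quad_lap !degop_deriv !spderivD spderivN.
by rewrite mulrnDl [in RHS]opprD [RHS]addrACA !mulr2n !opprD !addrA.
Qed.

(** By [degopE] a nonzero coefficient forces the eigenvalue to be the degree of its monomial. *)
Lemma degop_eigen_eq0 (c : C) p :
  (forall j : nat, j%:R != c) -> degop p = c *: p -> p = 0.
Proof.
move=> cP e; apply/ffunP => U; apply/mpolyP => a.
have := degopE p U a; rewrite e spscaleE mcoeffZ sp0E mcoeff0 => /eqP.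
rewrite eq_sym -subr_eq0 -mulrBl mulf_eq0 subr_eq0 (negPf (cP _)) /=.
by move/eqP.
Qed.

(** * Cauchy-Kovalevskaya extension *)

Definition zpow r p : P := iter r (fun q => z0 * q) p.

Lemma zpowZ r (c : C) p : zpow r (c *: p) = c *: zpow r p.
Proof. by elim: r => //= r ->; rewrite -scalerAr. Qed.

Lemma zpow0 r : zpow r 0 = 0.
Proof. by elim: r => //= r ->; rewrite mulr0. Qed.

Lemma perp_lap_zpow r p : perp_lap (zpow r p) = zpow r (perp_lap p).
Proof. by elim: r => //= r <-; rewrite perp_lap_z0. Qed.

Lemma degop_zpow r p : degop (zpow r p) = r%:R *: zpow r p + zpow r (degop p).
Proof.
elim: r => [|r IH]; first by rewrite scale0r add0r.
rewrite /= degop_var IH mulrDr -scalerAr addrA.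
by rewrite -[r.+1%:R]nat1r scalerDl scale1r.
Qed.

Lemma d0_zpow r p : d0 p = 0 -> d0 (zpow r p) = r%:R *: zpow r.-1 p.
Proof.
move=> p0; elim: r => [|r IH]; first by rewrite scale0r.
rewrite /= d0_z0 IH -scalerAr -[r.+1%:R]nat1r scalerDl scale1r.
by case: r {IH} => [|r] //; rewrite !scale0r.
Qed.

(** Divided powers of z_0: d_0 lowers the index without a numerical factor. *)
Definition zdpow r p : P := (r`!%:R)^-1 *: zpow r p.

Lemma d0_zdpow r p : d0 p = 0 -> d0 (zdpow r.+1 p) = zdpow r p.
Proof.
move=> p0; rewrite /zdpow spderivZ (d0_zpow _ p0) scalerA factS natrM /=.
by rewrite invfM mulrAC mulVf ?mul1r // pnatr_eq0.
Qed.

Lemma d0_zdpow0 p : d0 p = 0 -> d0 (zdpow 0 p) = 0.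
Proof.
by move=> p0; rewrite /zdpow spderivZ (d0_zpow _ p0) scale0r scaler0.
Qed.

(** -d_0^2 of each term cancels [perp_lap] of the preceding one, so Delta of a partial sum
    telescopes to one term, which finally vanishes for degree reasons. *)
Lemma harmonic_extension (e g : nat) f : (e <= 1)%N -> d0 f = 0 ->
    degop f = g%:R *: f ->
  exists h q, [/\ h = zpow e f + z0 * (z0 * q), quad_lap h = 0 &
    degop h = (g + e)%:R *: h].
Proof.
move=> e1 f0 fg.
pose G (j : nat) := iter j perp_lap f.
have G0 (j : nat) : d0 (G j) = 0.
  elim: j => [|j IH]; first exact: f0.
  rewrite [G j.+1]/(perp_lap (G j)) d0_perp_lap IH.
  by have := perp_lapZ 0 0; rewrite !scale0r.
have Gg (j : nat) : degop (G j) = (g%:R - (2 * j)%:R) *: G j.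
  elim: j => [|j IH]; first by rewrite muln0 subr0.
  rewrite [G j.+1]/(perp_lap (G j)) degop_perp_lap IH perp_lapZ mulnS.
  rewrite natrD [in RHS]opprD.
  by rewrite [in RHS]addrCA [in RHS]addrC [RHS]scalerBl scaler_nat.
(* Its Euler eigenvalue would be g - 2 (g + 1) < 0. *)
have GN : G g.+1 = 0.
  apply: degop_eigen_eq0 (Gg _) => j.
  by rewrite eq_sym subr_eq -natrD eqr_nat; lia.
pose h N : P := \sum_(j < N) zdpow (2 * j + e) (G j).
have hS N : h N.+1 = h N + zdpow (2 * N + e) (G N).
  by rewrite /h big_ord_recr.
have hlap N : quad_lap (h N.+1) = zdpow (2 * N + e) (G N.+1).
  have lapzd r (j : nat) : perp_lap (zdpow r (G j)) = zdpow r (G j.+1).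
    by rewrite /zdpow perp_lapZ perp_lap_zpow.
  elim: N => [|N IH].
    rewrite /h big_ord1 quad_lapE lapzd.
    (* As e <= 1, two applications of d_0 kill the first term. *)
    case: e e1 {h hS} => [|[|//]] _.
      by rewrite d0_zdpow0 // spderiv0 subr0.
    by rewrite d0_zdpow // d0_zdpow0 // subr0.
  rewrite hS quad_lapD IH [quad_lap (zdpow _ _)]quad_lapE.
  rewrite lapzd mulnS !addSn !d0_zdpow //.
  by rewrite addrCA subrr addr0.
exists (h g.+1).
have [q hq] : exists q, h g.+1 = zpow e f + z0 * (z0 * q).
  rewrite /h big_ord_recl /=.
  (* Every term after the first contains z_0^2, which is split off while the factorials stay. *)
  exists (\sum_(j < g) (((2 * j.+1 + e)`!%:R)^-1 *: zpow (2 * j + e) (G j.+1))).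
  congr (_ + _).
    by rewrite /zdpow; case: e e1 {h hS hlap} => [|[|//]] _;
      rewrite invr1 scale1r.
  rewrite !mulr_sumr; apply: eq_bigr => j _.
  by rewrite /zdpow -!scalerAr /bump leq0n add1n mulnS.
exists q; split=> //; first by rewrite hlap GN /zdpow zpow0 scaler0.
rewrite /h degop_sum scaler_sumr; apply: eq_bigr => j _.
rewrite /zdpow degopZ degop_zpow Gg zpowZ -scalerDl !scalerA mulrC.
congr ((_ * _) *: _).
by rewrite !natrD; ring.
Qed.

(** * Nondegeneracy against harmonic polynomials *)

Lemma mcoeff_z0z0 p U (a : 'X_{1..m}) :
  (a a0 <= 1)%N -> ((z0 * (z0 * p)) U)@_a = 0.
Proof.
rewrite !spvar_evenM; case: (posnP (a a0)) => [a0E _|a_gt0 a_le1].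
  by rewrite mcoeffXM_eq0.
have aE : a a0 = 1%N by lia.
have ea : a = ((a - U_(a0)) + U_(a0))%MM.
  rewrite submK //; apply/mnm_lepP => l; rewrite mnm1E.
  by case: eqP => // <-; rewrite aE.
by rewrite ea mcoeffXM mcoeffXM_eq0 // mnmBE mnm1E eqxx aE.
Qed.

Lemma harmonic_nondegenerate p :
    (forall h (g : nat), quad_lap h = 0 -> degop h = g%:R *: h ->
       (poly_op p h set0)@_0%MM = 0) ->
  exists r, p = r * quad.
Proof.
move=> H; have [r [q [pE qlow]]] := division_quad p.
exists r; suff q0 : q = 0 by rewrite pE q0 addr0.
(* Applying d_0 twice multiplies this coefficient by a nonzero integer, so [qlow] forces it to
   vanish. *)
have low S (a : 'X_{1..m}) : (1 < a a0)%N -> (q S)@_a = 0.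
  move=> a_gt1; have ea : a = ((a - U_(a0) *+ 2) + U_(a0) + U_(a0))%MM.
    apply/mnmP => l; rewrite !mnmDE mnmBE mulmnE mnm1E.
    by case: eqP => [<-|_]; lia.
  have : (d0 (d0 q) S)@_(a - U_(a0) *+ 2) = 0 by rewrite qlow sp0E mcoeff0.
  rewrite !spderiv_lshift !mcoeff_deriv -ea => /eqP.
  by rewrite !mulrn_eq0 /= => /eqP.
apply/ffunP => S; apply/mpolyP => a; rewrite sp0E mcoeff0.
apply/eqP/negPn/negP => qa0.
have a_le1 : (a a0 <= 1)%N by rewrite leqNgt; apply: contra qa0 => /low->.
(* The z_0-free part of the offending exponent. Below, f is dual to z^b theta_S up to a scalar, and
   [a a0] serves as e. *)
pose b := (a - U_(a0) *+ a a0)%MM.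
have ba : b a0 = 0%N by rewrite /b mnmBE mulmnE mnm1E eqxx mul1n subnn.
have ab : a = (U_(a0) *+ a a0 + b)%MM.
  rewrite addmC submK //; apply/mnm_lepP => l; rewrite mulmnE mnm1E.
  by case: eqP => // <-; rewrite mul1n.
pose f : P := spmonom 'X_[b] (delta @: S).
have f0 : d0 f = 0.
  apply/ffunP => U; rewrite spderiv_lshift ffunE sp0E; case: eqP => _.
    by rewrite mderivX ba scale0r.
  by rewrite mderiv0.
have fg : degop f = (mdeg b + #|delta @: S|)%:R *: f.
  apply/ffunP => U; apply/mpolyP => x; rewrite degopE spscaleE mcoeffZ ffunE.
  case: eqP => [->|_]; last by rewrite mcoeff0 !mulr0.
  by rewrite mcoeffX; case: eqP => [->|_]; rewrite ?mulr0.
have [h [w [hE hlap hdeg]]] := harmonic_extension a_le1 f0 fg.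
(* h differs from z^a theta_T, T = [delta @: S], only by a multiple of z_0^2, invisible at exponents
   at most 1 in z_0. *)
have hcoef U (x : 'X_{1..m}) : (x a0 <= 1)%N ->
    (h U)@_x = ((U == delta @: S) && (a == x))%:R.
  move=> x_le1; rewrite hE spaddE mcoeffD mcoeff_z0z0 // addr0.
  have -> : zpow (a a0) f U = 'X_a0 ^+ (a a0) * f U.
    elim: (a a0) => [|y IH]; first by rewrite mul1r.
    by rewrite [zpow _ _]/= spvar_evenM IH mulrA exprS.
  rewrite ffunE; case: eqP => _; last by rewrite mulr0 mcoeff0.
  by rewrite mpolyXn -mpolyXD -ab mcoeffX.
have := H h _ hlap hdeg.
(* The multiple of R^2 drops out by adjointness, since h is harmonic. *)
rewrite pE poly_opD poly_opM poly_op_quad hlap.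
have -> : poly_op r 0 = 0.
  have := poly_opDr tlowD r 0 0; rewrite addr0 -{1}[poly_op r 0]addr0.
  by move/addrI.
rewrite add0r /poly_op sum_ffunE raddf_sum.
have [u u0 uE] := mono_op_coef a S.
(* As q has degree at most 1 in z_0, only its monomial z^a theta_S pairs with h. *)
rewrite (bigD1 S) //= [X in _ + X]big1 ?addr0; last first.
  move=> U US; rewrite sum_ffunE raddf_sum big1_seq // => x /andP[_ xq] /=.
  rewrite spscaleE mcoeffZ.
  have [v v0 ->] := mono_op_coef x U.
  rewrite hcoef; last first.
    rewrite leqNgt; apply: contraL xq => /low xq.
    by rewrite mcoeff_msupp xq eqxx.
  by rewrite (inj_eq (imset_inj delta_inj)) (negPf US) !mulr0.
rewrite sum_ffunE raddf_sum (bigD1_seq a) ?msupp_uniq ?mcoeff_msupp //=.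
rewrite big1_seq ?addr0; last first.
  move=> x /andP[xa xq] /=; rewrite spscaleE mcoeffZ.
  have [v v0 ->] := mono_op_coef x S.
  rewrite hcoef; last first.
    rewrite leqNgt; apply: contraL xq => /low xq.
    by rewrite mcoeff_msupp xq eqxx.
  by rewrite eq_sym in xa; rewrite (negPf xa) andbF !mulr0.
rewrite spscaleE mcoeffZ uE hcoef // !eqxx mulr1 => /eqP.
by rewrite mulf_eq0 (negPf qa0) (negPf u0).
Qed.

End Nondegenerate.

(** * The given beta and its modified Bessel operators *)

Section Bessel.
Variables (C : numClosedFieldType) (m n : nat).
Hypothesis m_gt0 : (0 < m)%N.
Local Notation P := (superpoly C m (2 * n)).
Local Notation I := 'I_(m + 2 * n).
Local Notation z := (@spvar C m (2 * n)).
Local Notation d := (@spderiv C m (2 * n)).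
Local Notation ksign := (@ksign C m (2 * n)).
Local Notation Rsq := (@Rsq C m n).
Implicit Types (p q r : P) (i j l : I).

(** The column of the only nonzero entry in row v of beta; [bsign] is that entry. *)
Definition dual_val (v : nat) : nat :=
  (if v < m then v else if v < m + n then v + n else v - n)%N.

Lemma dual_subproof i : (dual_val i < m + 2 * n)%N.
Proof. by rewrite /dual_val; have := ltn_ord i; do !case: ifP; lia. Qed.

Definition dual i : I := Ordinal (dual_subproof i).

Definition bsign i : C :=
  if (i == 0 :> nat) || (m <= i < m + n)%N then -1 else 1.

Lemma dualK : involutive dual.
Proof.
move=> i; apply/val_inj; rewrite /= /dual_val; have := ltn_ord i.
by case: (ltnP i m); case: (ltnP i (m + n)); do !case: ifP; lia.
Qed.

Lemma parity_dual i : parity (dual i) = parity i.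
Proof.
rewrite /parity /= /dual_val; have := ltn_ord i.
by case: (ltnP i m); case: (ltnP i (m + n)); lia.
Qed.

Lemma bsign2 i : bsign i * bsign i = 1.
Proof. by rewrite /bsign; case: ifP; rewrite ?mulrNN mulr1. Qed.

Lemma bsign_dual i : bsign (dual i) = ksign i i * bsign i.
Proof.
rewrite /bsign /ksign /parity /= /dual_val; have := ltn_ord i.
case: (ltnP i m) => im.
  by rewrite mul0n expr0 mul1r [(m <= _)%N]leqNgt im.
rewrite (_ : (-1) ^+ (true * true) = -1 :> C) // mulN1r.
case: (ltnP i (m + n)) => imn ilt; rewrite ?andbT ?orbT ?andbF.
  have -> : ((i + n == 0) || (m <= i + n < m + n))%N = false by lia.
  by rewrite opprK.
have -> : ((i - n == 0) || (m <= i - n < m + n))%N by lia.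
by have -> : ((i == 0 :> nat) || false)%N = false by lia.
Qed.

Lemma betaE i j : beta C m n i j = bsign i * (j == dual i)%:R.
Proof.
have -> : (j == dual i) = (j == dual_val i :> nat) by [].
rewrite mxE /bsign /dual_val; have := ltn_ord i.
case: eqP => [->|i0] /=.
  by rewrite m_gt0 mulN1r; case: eqP; rewrite ?oppr0.
case: (ltnP i m) => im /=; first by rewrite mul1r -val_eqE eq_sym.
case: (ltnP i (m + n)) => imn /=.
  by rewrite mulN1r; case: eqP; rewrite ?oppr0.
by move=> _; rewrite mul1r; congr (_%:R); lia.
Qed.

Lemma betaVE i j : invmx (beta C m n) i j = bsign j * (i == dual j)%:R.
Proof.
have e : beta C m n *m (beta C m n)^T = 1%:M.
  apply/matrixP => a b; rewrite mxE [RHS]mxE (bigD1 (dual a)) //= big1 ?addr0.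
    rewrite [X in _ * X]mxE !betaE eqxx mulr1 (inj_eq (can_inj dualK)).
    by case: eqP => [->|]; rewrite ?mulr1 ?mulr0 // bsign2.
  by move=> c /negPf ca; rewrite betaE ca mulr0 mul0r.
have [u _] := mulmx1_unit e.
have -> : invmx (beta C m n) = (beta C m n)^T.
  by rewrite -[RHS]mul1mx -(mulVmx u) -mulmxA e mulmx1.
by rewrite mxE betaE.
Qed.

Local Notation quad := (quad dual bsign).
Local Notation quad_lap := (quad_lap dual bsign).
Local Notation lower := (lower dual bsign).

Lemma dual_even (a : 'I_m) : dual (lshift _ a) = lshift _ a.
Proof. by apply: val_inj; rewrite /= /dual_val ltn_ord. Qed.

Lemma odd_dual_subproof (b : 'I_(2 * n)) :
  ((if b < n then b + n else b - n) < 2 * n)%N.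
Proof. by have := ltn_ord b; case: ifP; lia. Qed.

Definition odd_dual b : 'I_(2 * n) := Ordinal (odd_dual_subproof b).

Lemma dual_odd (b : 'I_(2 * n)) : dual (rshift m b) = rshift m (odd_dual b).
Proof.
apply: val_inj; rewrite /= /dual_val /= ltn_add2l.
by have := ltn_ord b; do !case: ifP; lia.
Qed.

Lemma sum_betaV (V : lmodType C) (F : I -> I -> V) :
  \sum_i \sum_j invmx (beta C m n) i j *: F i j =
  \sum_j bsign j *: F (dual j) j.
Proof.
rewrite exchange_big; apply: eq_bigr => j _ /=.
rewrite -[RHS](sum_delta (dual j) (fun i => bsign j *: F i j)).
by apply: eq_bigr => i _; rewrite betaVE scalerA mulrC.
Qed.

Lemma spderiv_lowE j p : spderiv_low j p = lower j p.
Proof.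
rewrite /spderiv_low -[RHS](sum_delta (dual j) (fun i => bsign j *: d i p)).
by apply: eq_bigr => i _; rewrite betaE scalerA mulrC.
Qed.

Lemma RsqE : Rsq = quad.
Proof. exact: sum_betaV. Qed.

Lemma eulerE p : euler p = degop p.
Proof.
rewrite /euler sum_betaV /degop.
rewrite (reindex_inj (can_inj dualK)) /=; apply: eq_bigr => j _.
by rewrite spderiv_lowE /lower dualK -scalerAr scalerA bsign2 scale1r.
Qed.

Lemma laplaceE p : laplace p = quad_lap p.
Proof.
rewrite /laplace sum_betaV [RHS](reindex_inj (can_inj dualK)) /=.
apply: eq_bigr => j _; rewrite !spderiv_lowE /lower spderivZ dualK !scalerA.
by rewrite mulrCA bsign2 mulr1.
Qed.

Lemma sum_ksign : \sum_j ksign j j = (superdim m n)%:~R :> C.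
Proof.
rewrite big_split_ord /= (eq_bigr (fun=> 1)) => [|a _]; last first.
  by rewrite /ksign parity_lshift.
rewrite [X in _ + X](eq_bigr (fun=> -1)) => [|a _]; last first.
  by rewrite /ksign parity_rshift.
by rewrite !sumr_const !card_ord mulNrn /superdim rmorphB.
Qed.

Lemma besselE i p : bessel i p = bess dual bsign (\sum_j ksign j j) i p.
Proof.
rewrite /bessel /bess spderiv_lowE eulerE laplaceE scaler_nat sum_ksign.
by rewrite rmorphB.
Qed.

(** The sign change at index 0 is that of [bessel_mod]. As [dual] fixes 0, products over dual pairs
    are unaffected. *)
Definition tsign i : C := if i == 0 :> nat then - bsign i else bsign i.

Local Notation tlow := (tlow dual tsign).
Local Notation i0 := (lshift (2 * n) (Ordinal m_gt0) : I).

Lemma bsign_i0 : bsign i0 = -1.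
Proof. by []. Qed.

Lemma bsign_neq0 i : bsign i != 0.
Proof. by rewrite /bsign; case: ifP; rewrite ?oppr_eq0 oner_eq0. Qed.

Lemma tsign_neq0 i : tsign i != 0.
Proof. by rewrite /tsign; case: ifP; rewrite ?oppr_eq0 bsign_neq0. Qed.

Lemma tsign_dual i : tsign (dual i) * tsign i = bsign (dual i) * bsign i.
Proof.
rewrite /tsign; have -> : (dual i == 0 :> nat) = (i == 0 :> nat).
  rewrite /= /dual_val; have := ltn_ord i.
  by case: (ltnP i m); case: (ltnP i (m + n)); lia.
by case: ifP; rewrite ?mulrNN.
Qed.

Lemma bessel_mod_Rsq i p : exists r, bessel_mod i (Rsq * p) = Rsq * r.
Proof.
rewrite /bessel_mod besselE RsqE bess_quad; last exact: bsign_dual.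
- by case: ifP => _; rewrite -?mulrN; eexists.
- exact: dualK.
- exact: parity_dual.
exact: bsign2.
Qed.

(** The term z_k Delta drops out and E acts on the derivative as c - 1. The eigenvalue is a scalar,
    so the derivative of a constant needs no separate case. *)
Lemma bessel_mod_harmonic i p (c : C) : quad_lap p = 0 -> degop p = c *: p ->
  [/\ bessel_mod i p = ((superdim m n)%:~R - 2 + 2 * (c - 1)) *: tlow i p,
   quad_lap (tlow i p) = 0 & degop (tlow i p) = (c - 1) *: tlow i p].
Proof.
move=> p0 pc.
have lowE : degop (lower i p) = (c - 1) *: lower i p.
  by rewrite degop_lower pc lowerZ scalerBl scale1r.
have tlowE : tlow i p = (if i == 0 :> nat then -1 else 1) *: lower i p.
  rewrite /tlow /lower /tsign scalerA.
  by case: ifP; rewrite ?mulN1r ?mul1r.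
split.
- rewrite tlowE /bessel_mod besselE /bess p0 mulr0 subr0 lowE sum_ksign.
  rewrite -scaler_nat (scalerA 2 (c - 1)) -scalerDl [in RHS]scalerA.
  by case: ifP => _; rewrite ?mulr1 // mulrN1 scaleNr.
- rewrite tlowE quad_lapZ quad_lap_lower ?p0; last exact: parity_dual.
  by rewrite /lower spderiv0 !scaler0.
by rewrite tlowE degopZ lowE !scalerA (mulrC (c - 1)).
Qed.

Local Notation bmod := (@bessel_mod C m n).
Local Notation M := ((superdim m n)%:~R : C).

(** The scalar accumulated when l Bessel operators act in turn on a harmonic polynomial of degree g;
    factor j belongs to degree g - j. *)
Definition bessel_coef (g l : nat) : C :=
  \prod_(j < l) (M - 2 + 2 * (g%:R - j%:R - 1)).

(** The invariant after l operators: p is the result on the Bessel side, q the one on the Fischer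
    side. *)
Definition bessel_step (g l : nat) p q :=
  [/\ p = bessel_coef g l *: q, quad_lap q = 0 & degop q = (g%:R - l%:R) *: q].

Lemma bessel_modZ i (c : C) p : bmod i (c *: p) = c *: bmod i p.
Proof.
by rewrite /bessel_mod !besselE bessZ; case: ifP => // _; rewrite scalerN.
Qed.

Lemma bessel_modD i p q : bmod i (p + q) = bmod i p + bmod i q.
Proof.
by rewrite /bessel_mod !besselE bessD; case: ifP => // _; rewrite opprD.
Qed.

Lemma bessel_stepS g (l : nat) i p q :
  bessel_step g l p q -> bessel_step g l.+1 (bmod i p) (tlow i q).
Proof.
move=> [-> q0 qg]; have [be t0 tg] := bessel_mod_harmonic i q0 qg.
split=> //; first by rewrite bessel_modZ be scalerA /bessel_coef big_ord_recr.
by rewrite tg -[l.+1%:R]natr1 opprD addrA.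
Qed.

Lemma bessel_step_mono g a (S : {set 'I_(2 * n)}) p :
    quad_lap p = 0 -> degop p = g%:R *: p ->
  exists l : nat, bessel_step g l (mono_op bmod a S p) (mono_op tlow a S p).
Proof.
move=> p0 pg.
have [l lP] : exists l : nat,
    bessel_step g l (odd_op bmod S p) (odd_op tlow S p).
  rewrite /odd_op; elim: (enum _) => [|b s [l IH]].
    exists 0%N; split=> //; last by rewrite subr0.
    by rewrite /bessel_coef big_ord0 scale1r.
  by exists l.+1; exact: (bessel_stepS (rshift m b) IH).
rewrite /mono_op /even_op; elim: (enum _) => [|i s [l' IH]]; first by exists l.
rewrite /=; elim: (a i) => [|r [l'' IHr]]; first by exists l'.
by exists l''.+1; exact: (bessel_stepS (lshift (2 * n) i) IHr).
Qed.

(** If the number l of operators differs from g, the result has Euler eigenvalue g - l <> 0 and both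
    constant terms vanish; so only l = g matters. *)
Lemma eval0_mono_op g a (S : {set 'I_(2 * n)}) p :
    quad_lap p = 0 -> degop p = g%:R *: p ->
  eval0 (mono_op bmod a S p) = bessel_coef g g * eval0 (mono_op tlow a S p).
Proof.
move=> p0 pg; have [l [-> _ qg]] := bessel_step_mono a S p0 pg.
rewrite /eval0 spscaleE mcoeffZ; case: (eqVneq l g) => [->//|lg].
have := degopE (mono_op tlow a S p) set0 0%MM.
rewrite qg spscaleE mcoeffZ mdeg0 cards0 mul0r => /eqP.
rewrite mulf_eq0 subr_eq0 eqr_nat eq_sym (negPf lg) /= => /eqP->.
by rewrite !mulr0.
Qed.

Lemma eval0_poly_op g r p : quad_lap p = 0 -> degop p = g%:R *: p ->
  eval0 (poly_op bmod r p) = bessel_coef g g * eval0 (poly_op tlow r p).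
Proof.
move=> p0 pg; rewrite /eval0 /poly_op !sum_ffunE !raddf_sum mulr_sumr.
apply: eq_bigr => S _; rewrite !sum_ffunE !raddf_sum mulr_sumr.
apply: eq_bigr => a _ /=; rewrite !spscaleE.
rewrite (mcoeffZ ((r S)@_a)) (mcoeffZ ((r S)@_a)) mulrCA.
by congr (_ * _); exact: (eval0_mono_op a S p0 pg).
Qed.

(** A vanishing factor would give M - 2 = -2 (g - 1 - j), a value that the hypothesis excludes. *)
Lemma bessel_coef_neq0 g :
  (forall k : nat, superdim m n - 2 <> - (2 * k)%:Z) -> bessel_coef g g != 0.
Proof.
move=> hM; apply/prodf_neq0 => j _; have jg := ltn_ord j.
(* As j < g, the subtraction of natural numbers is not truncated. *)
have -> : M - 2 + 2 * (g%:R - j%:R - 1) =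
    (superdim m n - 2 + (2 * (g - j.+1))%:Z)%:~R.
  rewrite [in RHS]intrD [in RHS]intrB -[in RHS]pmulrn natrM natrB //.
  rewrite -[j.+1%:R]natr1.
  by rewrite (opprD (j%:R)) [in RHS]addrA.
rewrite intr_eq0 addr_eq0; apply/eqP; exact: hM.
Qed.

(** * Compatibility with the ideal of R^2 and passage to the Fock space *)

Lemma poly_op_Rsq r p : exists q, poly_op bmod r (Rsq * p) = Rsq * q.
Proof.
pose Q v := exists q, v = Rsq * q.
have QB i v : Q v -> Q (bmod i v) by move=> [q ->]; apply: bessel_mod_Rsq.
have Qmono a S : Q (mono_op bmod a S (Rsq * p)).
  have : Q (odd_op bmod S (Rsq * p)).
    rewrite /odd_op; elim: (enum _) => [|b s IH]; first by exists p.
    exact: QB.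
  rewrite /mono_op /even_op => Q0; elim: (enum _) => //= i s IH.
  by elim: (a i) => //= l; apply: QB.
have Qsum (J : Type) (s : seq J) (F : J -> P) :
    (forall x, Q (F x)) -> Q (\sum_(x <- s) F x).
  move=> QF; apply: (big_ind Q) => // [|u v [q1 ->] [q2 ->]].
    by exists 0; rewrite mulr0.
  by exists (q1 + q2); rewrite mulrDr.
apply: (Qsum) => S; apply: (Qsum) => a; have [q ->] := Qmono a S.
by exists ((r S)@_a *: q); rewrite scalerAr.
Qed.

Lemma eval0_Rsq p : eval0 (Rsq * p) = 0.
Proof.
rewrite RsqE quadM /eval0 sum_ffunE raddf_sum big1 // => j _ /=.
rewrite spscaleE mcoeffZ; case: (shiftP (dual j)) => a.
  by rewrite spvar_evenM mcoeffXM_eq0 ?mulr0 // mnm0E.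
by rewrite spvar_oddM inE mcoeff0 mulr0.
Qed.

Lemma Rsq_comm p : p * Rsq = Rsq * p.
Proof.
by rewrite RsqE; apply: quad_comm; [exact: dual_even | exact: dual_odd].
Qed.

(** R^2 is central, so two-sided combinations collapse to multiples. *)
Lemma gen_idealP p : (p \in gen_ideal P Rsq) <-> exists q, p = Rsq * q.
Proof.
split=> [/asboolP[s ->]|[q ->]].
  exists (\sum_(ab <- s) ab.1 * ab.2); rewrite mulr_sumr.
  by apply: eq_bigr => ab _; rewrite [ab.1 * _]Rsq_comm -mulrA.
by apply/asboolP; exists [:: (1, q)]; rewrite big_seq1 mul1r.
Qed.

Lemma conj_coefE q U a : (conj_coef q U)@_a = ((q U)@_a)^*.
Proof. by rewrite ffunE mcoeff_map_mpoly. Qed.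

Lemma conj_coefK : involutive (@conj_coef C m n).
Proof.
by move=> q; apply/ffunP => U; apply/mpolyP => a; rewrite !conj_coefE conjCK.
Qed.

Lemma conj_coefD p q : conj_coef (p + q) = conj_coef p + conj_coef q.
Proof.
apply/ffunP => U; apply/mpolyP => a.
by rewrite spaddE mcoeffD !conj_coefE spaddE mcoeffD rmorphD.
Qed.

Lemma conj_coefZ (c : C) p : conj_coef (c *: p) = c^* *: conj_coef p.
Proof.
apply/ffunP => U; apply/mpolyP => a.
by rewrite spscaleE mcoeffZ !conj_coefE spscaleE mcoeffZ rmorphM.
Qed.

Lemma conj_coef_var i p : conj_coef (z i * p) = z i * conj_coef p.
Proof.
apply/ffunP => U; apply/mpolyP => a; rewrite conj_coefE; case: (shiftP i) => b.
  rewrite !spvar_evenM; case: (posnP (a b)) => ab.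
    by rewrite !mcoeffXM_eq0 // conjC0.
  have ea : a = ((a - U_(b)) + U_(b))%MM.
    by apply/mnmP => x; rewrite !mnmDE mnmBE mnm1E; case: eqP => [<-|_]; lia.
  by rewrite ea !mcoeffXM conj_coefE.
rewrite !spvar_oddM; case: ifP => _; last by rewrite mcoeff0 conjC0.
by rewrite -!scale_sign !mcoeffZ conj_coefE rmorphM rmorph_sign.
Qed.

Lemma conj_coef_Rsq p : conj_coef (Rsq * p) = Rsq * conj_coef p.
Proof.
rewrite RsqE !quadM.
have -> (F : I -> P) : conj_coef (\sum_j F j) = \sum_j conj_coef (F j).
  apply: (big_morph _ conj_coefD); apply/ffunP => U; apply/mpolyP => a.
  by rewrite conj_coefE !sp0E mcoeff0 conjC0.
apply: eq_bigr => j _; rewrite conj_coefZ !conj_coef_var; congr (_ *: _).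
(* The signs in R^2 are 1 and -1, hence fixed by conjugation. *)
by rewrite /bsign; case: ifP => _; rewrite ?conjCN1 ?conjC1.
Qed.

Lemma repr_pi (q : P) : exists r,
  repr (\pi_(fock C m n) q)%qT = q + Rsq * r.
Proof.
have : repr (\pi_(fock C m n) q)%qT - q \in gen_ideal P Rsq.
  by rewrite Quotient.idealrBE reprK.
move=> /gen_idealP[r rE]; exists r.
by rewrite -rE addrC subrK.
Qed.

(** The form conjugates its second argument, so p is tested on the class of the conjugate of h. The
    chosen representative is off by a multiple of R^2, which contributes 0; the nonzero factor
    [bessel_coef g g] is then cancelled. *)
Lemma fock_form_harmonic (p : fock C m n) h (g : nat) :
    (forall k : nat, superdim m n - 2 <> - (2 * k)%:Z) ->
    (forall f : fock C m n, fock_form p f = 0) ->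
    quad_lap h = 0 -> degop h = g%:R *: h ->
  eval0 (poly_op tlow (repr p) h) = 0.
Proof.
move=> hM hp h0 hg; have := hp (\pi%qT (conj_coef h)).
rewrite /fock_form /bessel_fischer; have [r ->] := repr_pi (conj_coef h).
rewrite conj_coefD conj_coefK conj_coef_Rsq.
rewrite -[subst_op _ _ _]/(poly_op bmod (repr p) _) (poly_opDr bessel_modD).
have [q ->] := poly_op_Rsq (repr p) (conj_coef r).
have -> u v : eval0 (u + v) = eval0 u + eval0 v :> C.
  by rewrite /eval0 spaddE mcoeffD.
rewrite eval0_Rsq addr0 (eval0_poly_op _ h0 hg) => /eqP.
by rewrite mulf_eq0 (negPf (bessel_coef_neq0 g hM)) => /eqP.
Qed.

(** The representative of p is Fischer-orthogonal to all homogeneous harmonic polynomials, hence a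
    multiple of R^2. *)
Lemma fock_form_nondegenerate (p : fock C m n) :
    (forall k : nat, superdim m n - 2 <> - (2 * k)%:Z) ->
    (forall f : fock C m n, fock_form p f = 0) ->
  p = 0.
Proof.
move=> hM hp.
have [r pE] : exists r, repr p = r * quad.
  apply: (harmonic_nondegenerate dualK dual_even dual_odd bsign2 bsign_dual
    tsign_neq0 tsign_dual bsign_i0) => h g.
  exact: fock_form_harmonic.
have pi0 : (\pi_(fock C m n) 0)%qT = 0 :> fock C m n by rewrite piE.
rewrite -[p]reprK -pi0; apply/eqP; rewrite -Quotient.idealrBE subr0.
by apply/gen_idealP; exists r; rewrite pE -RsqE Rsq_comm.
Qed.

End Bessel.

Theorem proposition4p12 (R : realType) (m n : nat) (hm : (2 <= m)%N)
    (hM : forall k : nat, superdim m n - 2 <> - (2 * k)%:Z)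
    (p : fock R[i] m n)
    (hp : forall q : fock R[i] m n, fock_form p q = 0) :
  p = 0.
Proof. exact: (fock_form_nondegenerate (ltnW hm) hM hp). Qed.
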